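(* Let $p,q\ge1$, let $K=\langle x_1,\dots,x_p,y_1,\dots,y_q\rangle$ be the free group on $p+q$ generators, and let $\bar X$ (resp. $\bar Y$) be the normal closure in $K$ of $\{x_1,\dots,x_p\}$ (resp. $\{y_1,\dots,y_q\}$). Let $K_{*,*}=(K_{m,n})_{(m,n)\in\mathbb N^2}$ be the double lower central series of the triple $(K;\bar X,\bar Y)$, and let $\bar K$ be its associated $\mathbb N^2_+$-graded Lie algebra. Let $\mathsf A=\{a_1,\dots,a_p\}$ and $\mathsf B=\{b_1,\dots,b_q\}$ be disjoint sets. Consider the map $$\varphi\colon\mathfrak{Lie}(\mathsf A,\mathsf B)\longrightarrow\bar K$$ induced by $a_i\mapsto x_iK_{>(1,0)}$ and $b_j\mapsto y_jK_{>(0,1)}$ for $1\le i\le p$ and $1\le j\le q$. Then $\varphi$ is an isomorphism of $\mathbb N^2_+$-graded Lie algebras. In particular, $\mathfrak{Lie}_{m,n}(\mathsf A,\mathsf B)\simeq\bar K_{m,n}$ for all $(m,n)\in\mathbb N^2_+$.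
   Context: $\mathbb N=\{0,1,2,\dots\}$, and $\mathbb N^2$ has componentwise addition and order; $\mathbb N^2_+=\mathbb N^2\setminus\{(0,0)\}$. For elements $a,b$ of a group, $[a,b]=aba^{-1}b^{-1}$; for subgroups $S,T$, $[S,T]$ is the subgroup generated by all $[s,t]$; $(\Gamma_nG)_{n\ge1}$ is the lower central series, $\Gamma_1G=G$, $\Gamma_{n+1}G=[\Gamma_nG,G]$. Double lower central series of $(K;\bar X,\bar Y)$, for normal subgroups $\bar X,\bar Y$ of $K$: the family of normal subgroups defined by $K_{0,0}=K$, $K_{m,0}=\Gamma_m\bar X$ ($m\ge1$), $K_{0,n}=\Gamma_n\bar Y$ ($n\ge1$), and $K_{m,n}=[K_{1,0},K_{m-1,n}]\,[K_{0,1},K_{m,n-1}]$ ($m,n\ge1$). It satisfies $[K_{m,n},K_{m',n'}]\subset K_{m+m',n+n'}$ and is decreasing. $K_{>(m,n)}=K_{m+1,n}\cdot K_{m,n+1}$, $\bar K_{m,n}=K_{m,n}/K_{>(m,n)}$, and $\bar K=\bigoplus_{(m,n)\in\mathbb N^2_+}\bar K_{m,n}$ is a Lie algebra over $\mathbb Z$, with bracket induced by the group commutator, graded so that $[\bar K_{m,n},\bar K_{m',n'}]\subset\bar K_{m+m',n+n'}$. $\mathfrak{Lie}(\mathsf A,\mathsf B)=\bigoplus_{(m,n)\in\mathbb N^2_+}\mathfrak{Lie}_{m,n}(\mathsf A,\mathsf B)$ is the free Lie algebra over $\mathbb Z$ on $\mathsf A\cup\mathsf B$, graded so that elements of $\mathsf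 A$ have degree $(1,0)$, elements of $\mathsf B$ have degree $(0,1)$, and the bracket is additive in degree. *)

(* Defs.v *)
From HB Require Import structures.
From mathcomp Require Import all_boot all_algebra.
From mathcomp Require Import boolp classical_sets.

Set Implicit Arguments.
Unset Strict Implicit.
Unset Printing Implicit Defensive.

Import GRing.Theory.

Local Open Scope classical_set_scope.
Local Open Scope quotient_scope.

Section Subgroups.
Local Open Scope group_scope.
Variable G : groupType.
Implicit Types (a b c g h : G) (A B C H N S T X Y : set G).

(* The commutator [~ a, b] of the library is a^-1 * b^-1 * a * b; the
   convention needed here is a * b * a^-1 * b^-1. *)
Definition comm a b : G := a * b * a^-1 * b^-1.

Definition is_subgroup H :=
  [/\ H 1, forall a b, H a -> H b -> H (a * b) & forall a, H a -> H a^-1].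

Definition is_normal N :=
  is_subgroup N /\ forall g a, N a -> N (g * a * g^-1).

Definition generated A : set G :=
  [set g | forall H, is_subgroup H -> A `<=` H -> H g].

Definition normal_closure A : set G :=
  [set g | forall N, is_normal N -> A `<=` N -> N g].

Definition commS S T : set G :=
  generated [set g | exists s t, [/\ S s, T t & g = comm s t]].

Definition mulS S T : set G :=
  [set g | exists s t, [/\ S s, T t & g = s * t]].

(* The series starts at lcs H 1 = H; the value lcs H 0 is a junk value. *)
Fixpoint lcs H n : set G :=
  if n is n'.+1 then (if n' is 0 then H else commS (lcs H n') H) else H.

Fixpoint dlcs X Y m : nat -> set G :=
  match m with
  | 0 => fun n => if n is 0 then [set: G] else lcs Y n
  | m'.+1 => fix row n := match n with
      | 0 => lcs X m'.+1
      | n'.+1 => mulS (commS X (dlcs X Y m' n)) (commS Y (row n'))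
      end
  end.

Lemma dlcs00 X Y : dlcs X Y 0 0 = [set: G]. Proof. by []. Qed.

Lemma dlcsm0 X Y m : (0 < m)%N -> dlcs X Y m 0 = lcs X m.
Proof. by case: m. Qed.

Lemma dlcs0n X Y n : (0 < n)%N -> dlcs X Y 0 n = lcs Y n.
Proof. by case: n. Qed.

Lemma dlcsSS X Y m n :
  dlcs X Y m.+1 n.+1 =
  mulS (commS (dlcs X Y 1 0) (dlcs X Y m n.+1))
       (commS (dlcs X Y 0 1) (dlcs X Y m.+1 n)).
Proof. by []. Qed.

Definition dlcs_gt X Y m n : set G :=
  mulS (dlcs X Y m.+1 n) (dlcs X Y m n.+1).

Lemma commE a b : comm a b = a * b * a^-1 * b^-1.
Proof. by []. Qed.

Lemma commK a b : (comm a b)^-1 = comm b a.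
Proof. by rewrite /comm !invgM !invgK !mulgA. Qed.

Lemma commgg a : comm a a = 1.
Proof. by rewrite /comm mulgK mulgV. Qed.

Lemma comm_mull a b c : comm (a * b) c = a * comm b c * a^-1 * comm a c.
Proof. by rewrite /comm !invgM !mulgA !mulgVK. Qed.

Lemma comm_mulr a b c : comm a (b * c) = comm a b * (b * comm a c * b^-1).
Proof. by rewrite /comm !invgM !mulgA !mulgVK. Qed.

Lemma conj_comm a b : a * b * a^-1 = comm a b * b.
Proof. by rewrite /comm mulgVK. Qed.

Lemma comm_conj c a b :
  c * comm a b * c^-1 = comm (c * a * c^-1) (c * b * c^-1).
Proof. by rewrite /comm !invgM !invgK !mulgA !mulgVK. Qed.

Lemma hall_witt a b c :
  comm (comm a b) (b * c * b^-1) * comm (comm b c) (c * a * c^-1)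
  * comm (comm c a) (a * b * a^-1) = 1.
Proof.
by rewrite /comm !invgM !invgK !mulgA ?(mulgVK, mulgK, mulgV, mulVg, mul1g).
Qed.

Lemma sub1 H : is_subgroup H -> H 1. Proof. by case. Qed.
Lemma subM H a b : is_subgroup H -> H a -> H b -> H (a * b).
Proof. by case=> _ + _; exact. Qed.
Lemma subV H a : is_subgroup H -> H a -> H a^-1.
Proof. by case=> _ _; exact. Qed.

Lemma nrm_sub N : is_normal N -> is_subgroup N. Proof. by case. Qed.
Lemma nrm_conj N g a : is_normal N -> N a -> N (g * a * g^-1).
Proof. by case=> _; exact. Qed.

Lemma nrm_commr N a b : is_normal N -> N a -> N (comm a b).
Proof.
move=> nN Na; rewrite /comm -!mulgA; apply: subM => //; first exact: nrm_sub.
by rewrite mulgA; apply: nrm_conj => //; apply: subV => //; exact: nrm_sub.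
Qed.

Lemma nrm_comml N a b : is_normal N -> N b -> N (comm a b).
Proof.
by move=> nN Nb; rewrite -commK; apply: subV; [exact: nrm_sub|exact: nrm_commr].
Qed.

Lemma gen_subgroup A : is_subgroup (generated A).
Proof.
split=> [H sH _|a b ga gb H sH AH|a ga H sH AH]; first exact: sub1.
- by apply: subM => //; [exact: ga|exact: gb].
- by apply: subV => //; exact: ga.
Qed.

Lemma sub_gen A : A `<=` generated A.
Proof. by move=> a Aa H _; exact. Qed.

Lemma gen_normal A :
  (forall g a, A a -> A (g * a * g^-1)) -> is_normal (generated A).
Proof.
move=> cA; split; first exact: gen_subgroup.
move=> g a ga.
apply: (ga [set a | generated A (g * a * g^-1)]) => [|b Ab /=]; last first.
  by apply: sub_gen; exact: cA.
split=> /= [|x y gx gy|x gx].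
- by rewrite mulg1 mulgV; exact: sub1 (gen_subgroup A).
- have -> : g * (x * y) * g^-1 = (g * x * g^-1) * (g * y * g^-1).
    by rewrite !mulgA mulgVK.
  exact: subM (gen_subgroup A) _ _.
- have -> : g * x^-1 * g^-1 = (g * x * g^-1)^-1 by rewrite !invgM invgK mulgA.
  exact: subV (gen_subgroup A) _.
Qed.

Lemma normal_closure_normal A : is_normal (normal_closure A).
Proof.
split; first split=> [N [sN _] _|a b ga gb N nN AN|a ga N nN AN].
- exact: sub1.
- by apply: subM; [exact: nrm_sub|exact: ga|exact: gb].
- by apply: subV; [exact: nrm_sub|exact: ga].
- by move=> g a ga N nN AN; apply: nrm_conj => //; exact: ga.
Qed.

Lemma sub_normal_closure A : A `<=` normal_closure A.
Proof. by move=> a Aa N _; exact. Qed.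

Lemma commS_in S T s t : S s -> T t -> commS S T (comm s t).
Proof. by move=> Ss Tt; apply: sub_gen; exists s, t. Qed.

Lemma commS_normal S T : is_normal S -> is_normal T -> is_normal (commS S T).
Proof.
move=> nS nT; apply: gen_normal => g _ [s [t [Ss Tt ->]]].
exists (g * s * g^-1), (g * t * g^-1).
by split; [exact: nrm_conj|exact: nrm_conj|rewrite comm_conj].
Qed.

Lemma commS_min S T H : is_subgroup H ->
  (forall s t, S s -> T t -> H (comm s t)) -> commS S T `<=` H.
Proof. by move=> sH STH g; apply=> // _ [s [t [Ss Tt ->]]]; exact: STH. Qed.

Lemma mulS_normal S T : is_normal S -> is_normal T -> is_normal (mulS S T).
Proof.
move=> nS nT; have sS := nrm_sub nS; have sT := nrm_sub nT.
split; first split.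
- by exists 1, 1; split; [exact: sub1|exact: sub1|rewrite mulg1].
- move=> _ _ [s [t [Ss Tt ->]]] [s' [t' [Ss' Tt' ->]]].
  exists (s * (t * s' * t^-1)), (t * t'); split.
  + by apply: subM => //; exact: nrm_conj.
  + exact: subM.
  + by rewrite !mulgA mulgVK.
- move=> _ [s [t [Ss Tt ->]]].
  exists (t^-1 * s^-1 * t^-1^-1), t^-1; split.
  + by apply: nrm_conj => //; exact: subV.
  + exact: subV.
  + by rewrite invgK mulgK invgM.
- move=> g _ [s [t [Ss Tt ->]]].
  exists (g * s * g^-1), (g * t * g^-1).
  by split; [exact: nrm_conj|exact: nrm_conj|rewrite !mulgA mulgVK].
Qed.

Lemma mulS_inl S T : is_normal T -> S `<=` mulS S T.
Proof.
move=> nT s Ss; exists s, 1.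
by split => //; [exact: sub1 (nrm_sub nT)|rewrite mulg1].
Qed.

Lemma mulS_inr S T : is_normal S -> T `<=` mulS S T.
Proof.
move=> nS t Tt; exists 1, t.
by split => //; [exact: sub1 (nrm_sub nS)|rewrite mul1g].
Qed.

Lemma mulS_min S T H : is_subgroup H -> S `<=` H -> T `<=` H -> mulS S T `<=` H.
Proof.
by move=> sH SH TH _ [s [t [Ss Tt ->]]]; exact: subM sH (SH _ Ss) (TH _ Tt).
Qed.

Lemma centr_subgroup N C : is_normal N ->
  is_subgroup [set a | forall c, C c -> N (comm a c)].
Proof.
move=> nN; have sN := nrm_sub nN; split=> /=.
- by move=> c _; rewrite /comm mul1g invg1 mulg1 mulgV; exact: sub1.
- move=> a b Ha Hb c Cc; rewrite comm_mull; apply: subM => //; last exact: Ha.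
  by apply: nrm_conj => //; exact: Hb.
- move=> a Ha c Cc.
  have -> : comm a^-1 c = a^-1 * (comm a c)^-1 * a^-1^-1.
    by rewrite commK /comm !invgK !mulgA mulgVK.
  by apply: nrm_conj => //; apply: subV => //; exact: Ha.
Qed.

Lemma three_subgroups A B C N a b c :
  is_normal A -> is_normal B -> is_normal N ->
  (forall a b c, A a -> B b -> C c -> N (comm (comm c a) b)) ->
  (forall a b c, A a -> B b -> C c -> N (comm (comm c b) a)) ->
  A a -> B b -> C c -> N (comm (comm a b) c).
Proof.
move=> nA nB nN H1 H2 Aa Bb Cc; have sN := nrm_sub nN.
set u := comm a b; set a' := comm c a; set b' := comm c b.
have Au : A u by exact: nrm_commr.
have Bu : B u by exact: nrm_comml.
have Aa' : A a' by exact: nrm_comml.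
have Bb' : B b' by exact: nrm_comml.
have cu : c * u * c^-1 = comm (a' * a) (b' * b).
  by rewrite {1}/u comm_conj !conj_comm.
suff : N (c * u * c^-1 * u^-1).
  have -> : c * u * c^-1 * u^-1 = (comm u c)^-1 by rewrite commK.
  by move=> /(subV sN); rewrite invgK.
rewrite cu comm_mull comm_mulr -/u.
have -> : a' * (comm a b' * (b' * u * b'^-1)) * a'^-1 * comm a' (b' * b) * u^-1
    = (a' * comm a b' * a'^-1) * (a' * comm b' u * a'^-1) * comm a' u
      * (u * comm a' (b' * b) * u^-1).
  clearbody a' b' u.
  by rewrite [comm b' u]commE [comm a' u]commE !mulgA !(mulgVK, mulgK).
have N1 : N (comm a b') by rewrite -commK; apply: subV => //; exact: H2.
have N2 : N (comm b' u) by exact: H2.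
have N3 : N (comm a' u) by exact: H1.
have N4 : N (comm a' (b' * b)).
  by apply: H1 => //; apply: subM => //; exact: nrm_sub.
have M1 := nrm_conj a' nN N1; have M2 := nrm_conj a' nN N2.
have M4 := nrm_conj u nN N4.
by apply: (subM sN) => //; apply: (subM sN) => //; apply: (subM sN).
Qed.

End Subgroups.
Record normal_triple := NormalTriple {
  nt_group :> groupType;
  nt_X : set nt_group;
  nt_Y : set nt_group;
  nt_normalX : is_normal nt_X;
  nt_normalY : is_normal nt_Y
}.

Section DoubleLowerCentralSeries.
Local Open Scope group_scope.
Variable T : normal_triple.
Local Notation X := (@nt_X T).
Local Notation Y := (@nt_Y T).
Implicit Types g h : T.
Local Notation nX := (nt_normalX T).
Local Notation nY := (nt_normalY T).

Definition dlcsT m n : set T := dlcs X Y m n.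
Definition dlcsT_gt m n : set T := dlcs_gt X Y m n.
Local Notation D := dlcsT.

Lemma lcs_normal (N : set T) n : is_normal N -> is_normal (lcs N n).
Proof.
by move=> nN; elim: n => [|[|n] IH] //=; exact: commS_normal.
Qed.

Lemma dlcs_normal m n : is_normal (D m n).
Proof.
rewrite /dlcsT; elim: m n => [|m IH] n.
  case: n => [|n]; first by split=> //; split.
  exact: lcs_normal (nY).
elim: n => [|n IHn]; first exact: lcs_normal nX.
rewrite dlcsSS; apply: mulS_normal; apply: commS_normal => //.
  exact: nX.
exact: nY.
Qed.

Lemma dlcs_sub m n : is_subgroup (D m n).
Proof. exact: nrm_sub (dlcs_normal m n). Qed.

Lemma dlcs_gt_normal m n : is_normal (dlcsT_gt m n).
Proof. by apply: mulS_normal; exact: dlcs_normal. Qed.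

Lemma dlcs_gt_sub m n : is_subgroup (dlcsT_gt m n).
Proof. exact: nrm_sub (dlcs_gt_normal m n). Qed.

Lemma dlcs_commX m n g h : X g -> D m n h -> D m.+1 n (comm g h).
Proof.
move=> Xg; rewrite /dlcsT; case: n => [|n] Dh.
  case: m Dh => [|m] Dh; first exact: nrm_commr nX _.
  by rewrite -commK; apply: (subV (dlcs_sub m.+2 0)); exact: commS_in.
rewrite dlcsSS; apply: mulS_inl; last exact: commS_in.
by apply: commS_normal; [exact: nY|exact: dlcs_normal].
Qed.

Lemma dlcs_commY m n g h : Y g -> D m n h -> D m n.+1 (comm g h).
Proof.
move=> Yg; rewrite /dlcsT; case: m => [|m] Dh.
  case: n Dh => [|n] Dh; first exact: nrm_commr nY _.
  by rewrite -commK; apply: (subV (dlcs_sub 0 n.+2)); exact: commS_in.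
rewrite dlcsSS; apply: mulS_inr; last exact: commS_in.
by apply: commS_normal; [exact: nX|exact: dlcs_normal].
Qed.

Lemma dlcs_commC m n g h : D m n (comm g h) -> D m n (comm h g).
Proof. by move=> H; rewrite -commK; exact: subV (dlcs_sub m n) H. Qed.

Lemma dlcs_comm_stepX m n :
  (forall m' n' g h, D m n g -> D m' n' h -> D (m + m') (n + n') (comm g h)) ->
  forall m' n' x g h, X x -> D m n g -> D m' n' h ->
  D (m.+1 + m') (n + n') (comm (comm x g) h).
Proof.
move=> IH m' n' x g h Xx Dg Dh.
apply: (three_subgroups (A := X) (B := D m n) (C := D m' n')) => //.
- exact: nX.
- exact: dlcs_normal.
- exact: dlcs_normal.
- move=> a b c Xa Db Dc; apply: dlcs_commC; rewrite addSnnS.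
  by apply: IH => //; apply: dlcs_commC; exact: dlcs_commX.
- move=> a b c Xa Db Dc; apply: dlcs_commC; rewrite addSn.
  by apply: dlcs_commX => //; apply: dlcs_commC; exact: IH.
Qed.

Lemma dlcs_comm_stepY m n :
  (forall m' n' g h, D m n g -> D m' n' h -> D (m + m') (n + n') (comm g h)) ->
  forall m' n' y g h, Y y -> D m n g -> D m' n' h ->
  D (m + m') (n.+1 + n') (comm (comm y g) h).
Proof.
move=> IH m' n' y g h Yy Dg Dh.
apply: (three_subgroups (A := Y) (B := D m n) (C := D m' n')) => //.
- exact: nY.
- exact: dlcs_normal.
- exact: dlcs_normal.
- move=> a b c Ya Db Dc; apply: dlcs_commC; rewrite addSnnS.
  by apply: IH => //; apply: dlcs_commC; exact: dlcs_commY.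
- move=> a b c Ya Db Dc; apply: dlcs_commC; rewrite addSn.
  by apply: dlcs_commY => //; apply: dlcs_commC; exact: IH.
Qed.

Lemma dlcs_comm m n m' n' g h :
  D m n g -> D m' n' h -> D (m + m') (n + n') (comm g h).
Proof.
elim: m n m' n' g h => [|m IHm].
  elim=> [|[|n] IHn] m' n' g h Dg Dh.
  - by apply: nrm_comml => //; exact: dlcs_normal.
  - exact: dlcs_commY.
  - have sN := centr_subgroup (D m' n') (dlcs_normal (0 + m') (n.+2 + n')).
    apply: (commS_min sN _ Dg) => // s t Ds Yt.
    rewrite -commK; apply: (subV sN) => c Dc.
    exact: dlcs_comm_stepY.
elim=> [|n IHn] m' n' g h Dg Dh.
  case: m IHm Dg => [|m] IHm Dg; first exact: dlcs_commX.
  have sN := centr_subgroup (D m' n') (dlcs_normal (m.+2 + m') (0 + n')).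
  apply: (commS_min sN _ Dg) => // s t Ds Xt.
  rewrite -commK; apply: (subV sN) => c Dc.
  by apply: dlcs_comm_stepX => // *; exact: IHm.
have sN := centr_subgroup (D m' n') (dlcs_normal (m.+1 + m') (n.+1 + n')).
move: Dg; rewrite /dlcsT dlcsSS => Dg.
apply: (mulS_min sN _ _ Dg) => //; apply: commS_min => //= s t Ds Dt c Dc.
  by apply: dlcs_comm_stepX => // *; exact: IHm.
by apply: dlcs_comm_stepY => // *; exact: IHn.
Qed.

Lemma dlcs_decrX m n : D m.+1 n `<=` D m n.
Proof.
elim: n => [|n IHn]; rewrite /dlcsT.
  case: m => [|m] //; apply: commS_min; first exact: (dlcs_sub m.+1 0).
  by move=> s t Ds _; apply: nrm_commr => //; exact: (dlcs_normal m.+1 0).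
rewrite dlcsSS; apply: mulS_min; first exact: dlcs_sub.
  apply: commS_min; first exact: dlcs_sub.
  by move=> s t _ Dt; apply: nrm_comml => //; exact: dlcs_normal.
apply: commS_min; first exact: dlcs_sub.
by move=> s t Ys Dt; apply: dlcs_commY => //; exact: IHn.
Qed.

Lemma dlcs_decrY m n : D m n.+1 `<=` D m n.
Proof.
elim: m => [|m IHm]; rewrite /dlcsT.
  case: n => [|n] //; apply: commS_min; first exact: (dlcs_sub 0 n.+1).
  by move=> s t Ds _; apply: nrm_commr => //; exact: (dlcs_normal 0 n.+1).
rewrite dlcsSS; apply: mulS_min; first exact: dlcs_sub.
  apply: commS_min; first exact: dlcs_sub.
  by move=> s t Xs Dt; apply: dlcs_commX => //; exact: IHm.
apply: commS_min; first exact: dlcs_sub.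
by move=> s t _ Dt; apply: nrm_comml => //; exact: dlcs_normal.
Qed.

Lemma dlcs_decr m n m' n' :
  (m <= m')%N -> (n <= n')%N -> D m' n' `<=` D m n.
Proof.
move=> /subnK <- /subnK <-; elim: (m' - m)%N => [|k IHk].
  elim: (n' - n)%N => [|k IHk] // g /dlcs_decrY; exact: IHk.
by move=> g /dlcs_decrX; exact: IHk.
Qed.

Lemma dlcs_gt_le m n : dlcsT_gt m n `<=` D m n.
Proof.
by apply: mulS_min; [exact: dlcs_sub|exact: dlcs_decrX|exact: dlcs_decrY].
Qed.

Lemma dlcs_gt_in m n m' n' : (m', n') != (0, 0) ->
  D (m + m') (n + n') `<=` dlcsT_gt m n.
Proof.
case: m' => [|m'].
  case: n' => [|n'] // _ g Dg; apply: mulS_inr; first exact: dlcs_normal.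
  by move: Dg; apply: dlcs_decr; rewrite ?addn0 ?addnS ?ltnS ?leq_addr.
move=> _ g Dg; apply: mulS_inl; first exact: dlcs_normal.
by move: Dg; apply: dlcs_decr; rewrite ?addnS ?ltnS ?leq_addr.
Qed.

Lemma dlcs_comm_gt m n m' n' g h :
  dlcsT_gt m n g -> D m' n' h -> dlcsT_gt (m + m') (n + n') (comm g h).
Proof.
have nN := dlcs_gt_normal (m + m') (n + n').
move=> Dg Dh; move: (h) Dh; apply: (mulS_min (centr_subgroup _ nN) _ _ Dg).
  move=> a Da b Db; apply: mulS_inl; first exact: dlcs_normal.
  exact: (dlcs_comm Da Db).
move=> a Da b Db; apply: mulS_inr; first exact: dlcs_normal.
exact: (dlcs_comm Da Db).
Qed.

End DoubleLowerCentralSeries.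

Arguments dlcsT : clear implicits.
Arguments dlcsT_gt : clear implicits.

(* Lie algebras over the ring of integers: the scalar multiplication is the one
   every abelian group has. *)
HB.mixin Record Zmodule_isLieRing L of GRing.Zmodule L := {
  lbr : L -> L -> L;
  lbrDl : forall u v w, lbr (u + v)%R w = (lbr u w + lbr v w)%R;
  lbrDr : forall u v w, lbr u (v + w)%R = (lbr u v + lbr u w)%R;
  lbrxx : forall u, lbr u u = 0%R;
  lbr_jacobi : forall u v w,
    (lbr u (lbr v w) + lbr v (lbr w u) + lbr w (lbr u v))%R = 0%R
}.

#[short(type="lieRingType")]
HB.structure Definition LieRing :=
  {L of GRing.Zmodule L & Zmodule_isLieRing L}.

Definition is_lie_morphism (L M : lieRingType) (f : L -> M) :=
  {morph f : u v / (u + v)%R} /\ {morph f : u v / lbr u v}.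

Definition N2p := {d : nat * nat | d != (0, 0)}.
Definition dx (d : N2p) := (val d).1.
Definition dy (d : N2p) := (val d).2.
Definition d10 : N2p := Sub (1, 0) isT.
Definition d01 : N2p := Sub (0, 1) isT.

Lemma N2p_neq0 (d : N2p) : (dx d, dy d) != (0, 0).
Proof. by case: d => -[]. Qed.

Definition is_dsum (e e' d : N2p) : bool :=
  (dx d == dx e + dx e') && (dy d == dy e + dy e').

Definition N2p_le (d : N2p) : seq N2p :=
  pmap insub [seq (i, j) | i <- iota 0 (dx d).+1, j <- iota 0 (dy d).+1].

Lemma mem_N2p_le d e : (e \in N2p_le d) = (dx e <= dx d) && (dy e <= dy d).
Proof.
rewrite mem_pmap_sub; apply/allpairsP/andP => [[[i j] []]|[lx ly]].
  by rewrite !mem_iota !add0n !ltnS => li lj; rewrite /dx /dy => ->.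
by exists (val e); rewrite !mem_iota !add0n !ltnS; split => //; case: (val e).
Qed.

Section GradedPiece.
Variables (T : normal_triple) (d : N2p).
Implicit Types g h : T.

Definition dlcs_elt := {g : T | g \in dlcsT T (dx d) (dy d)}.

Definition dlcs_rel (g h : dlcs_elt) : bool :=
  ((val g)^-1 * val h)%g \in dlcsT_gt T (dx d) (dy d).

Local Notation N := (dlcsT_gt T (dx d) (dy d)).
Let sN : is_subgroup N := @dlcs_gt_sub T (dx d) (dy d).
Let nN : is_normal N := @dlcs_gt_normal T (dx d) (dy d).
Local Notation D := (dlcsT T (dx d) (dy d)).
Let sD : is_subgroup D := @dlcs_sub T (dx d) (dy d).

Local Open Scope group_scope.

Lemma dlcs_rel_refl : reflexive dlcs_rel.
Proof. by move=> g; rewrite /dlcs_rel mulVg; exact: mem_set (sub1 sN). Qed.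

Lemma dlcs_rel_sym : symmetric dlcs_rel.
Proof.
by move=> g h; apply/idP/idP => /set_mem /(subV sN) H; apply/mem_set;
  move: H; rewrite invgM invgK.
Qed.

Lemma dlcs_rel_trans : transitive dlcs_rel.
Proof.
move=> g f h /set_mem H1 /set_mem H2; apply/mem_set.
by have := subM sN H1 H2; rewrite mulgA mulgK.
Qed.

Canonical dlcs_rel_equiv :=
  EquivRel dlcs_rel dlcs_rel_refl dlcs_rel_sym dlcs_rel_trans.

(* barK T d is the quotient of K_(m, n) by K_>(m, n), for d = (m, n). *)
Definition barK := {eq_quot dlcs_rel}.
HB.instance Definition _ := Choice.on barK.
HB.instance Definition _ := EqQuotient.on barK.

Definition dlcs_one : dlcs_elt := Sub 1 (mem_set (sub1 sD)).

(* The class modulo K_>(m, n) of an element of K_(m, n); the value outside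
   K_(m, n) is irrelevant. *)
Definition cls g : barK := \pi_barK (insubd dlcs_one g).

Definition rep (u : barK) : T := val (repr u).

Lemma rep_in u : D (rep u).
Proof. exact: set_mem (valP (repr u)). Qed.

Lemma repK u : cls (rep u) = u.
Proof. by rewrite /cls /rep valKd reprK. Qed.

Lemma clsP g h : D g -> D h -> cls g = cls h <-> N (g^-1 * h).
Proof.
move=> Dg Dh; rewrite /cls; split.
  by move=> /eqmodP /set_mem; rewrite !insubdK //; exact: mem_set.
by move=> H; apply/eqmodP; apply: mem_set; rewrite !insubdK //; exact: mem_set.
Qed.

Lemma cls_repP g : D g -> N (g^-1 * rep (cls g)).
Proof. by move=> Dg; apply/clsP => //; [exact: rep_in|rewrite repK]. Qed.

Lemma cls_N g : N g -> cls g = cls 1.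
Proof.
move=> Ng; symmetry; apply/clsP; [exact: sub1|exact: dlcs_gt_le|].
by rewrite invg1 mul1g.
Qed.

Lemma comm_N g h : D g -> D h -> N (comm g h).
Proof.
move=> Dg Dh; apply: (dlcs_gt_in (N2p_neq0 d)); exact: dlcs_comm.
Qed.

Lemma cls_mul_eq g g' h h' : D g -> D g' -> D h -> D h' ->
  cls g = cls g' -> cls h = cls h' -> cls (g * h) = cls (g' * h').
Proof.
move=> Dg Dg' Dh Dh' /(clsP Dg Dg') E1 /(clsP Dh Dh') E2.
apply/clsP; [exact: subM|exact: subM|].
have -> : (g * h)^-1 * (g' * h') =
  h^-1 * (g^-1 * g') * h^-1^-1 * (h^-1 * h').
  by rewrite invgM invgK !mulgA mulgK.
by apply: subM => //; exact: nrm_conj.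
Qed.

Lemma cls_mulC g h : D g -> D h -> cls (g * h) = cls (h * g).
Proof.
move=> Dg Dh; apply/clsP; [exact: subM|exact: subM|].
have -> : (g * h)^-1 * (h * g) = comm h^-1 g^-1.
  by rewrite /comm invgM !invgK !mulgA.
by apply: comm_N; exact: subV.
Qed.

Definition barK_add (u v : barK) : barK := cls (rep u * rep v).
Definition barK_opp (u : barK) : barK := cls (rep u)^-1.

Lemma barK_add_cls g h : D g -> D h -> barK_add (cls g) (cls h) = cls (g * h).
Proof.
move=> Dg Dh; apply: cls_mul_eq => //; try exact: rep_in; exact: repK.
Qed.

Lemma barK_addA : associative barK_add.
Proof.
move=> u v w; rewrite -[u]repK -[v]repK -[w]repK.
by have := (rep_in u, rep_in v, rep_in w) => -[[Du Dv] Dw];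
  rewrite !barK_add_cls ?mulgA //; exact: subM.
Qed.

Lemma barK_addC : commutative barK_add.
Proof. by move=> u v; apply: cls_mulC; exact: rep_in. Qed.

Lemma barK_add0 : left_id (cls 1) barK_add.
Proof.
move=> u; rewrite -{1}[u]repK barK_add_cls ?mul1g ?repK //; first exact: sub1.
exact: rep_in.
Qed.

Lemma barK_addN : left_inverse (cls 1) barK_opp barK_add.
Proof.
move=> u; rewrite -{2}[u]repK /barK_opp barK_add_cls ?mulVg //.
  by apply: subV => //; exact: rep_in.
exact: rep_in.
Qed.

HB.instance Definition _ :=
  GRing.isZmodule.Build barK barK_addA barK_addC barK_add0 barK_addN.

Lemma clsM g h : D g -> D h -> cls (g * h) = (cls g + cls h)%R.
Proof. by move=> *; rewrite [RHS]barK_add_cls. Qed.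

Lemma cls1 : cls 1 = 0%R. Proof. by []. Qed.

Lemma cls_eq0 g : N g -> cls g = 0%R.
Proof. by move=> /cls_N ->. Qed.

Lemma clsV g : D g -> cls g^-1 = (- cls g)%R.
Proof.
move=> Dg; apply/eqP; rewrite -addr_eq0 -clsM ?mulVg //; exact: subV.
Qed.

Lemma cls_conj (e : N2p) g h :
  dlcsT T (dx e) (dy e) g -> D h -> cls (g * h * g^-1) = cls h.
Proof.
move=> Dg Dh; symmetry; apply/clsP => //.
  by apply: nrm_conj => //; exact: dlcs_normal.
have -> : h^-1 * (g * h * g^-1) = comm h^-1 g by rewrite /comm invgK !mulgA.
apply: (dlcs_gt_in (N2p_neq0 e)); apply: dlcs_comm => //; exact: subV.
Qed.

End GradedPiece.

Section Bracket.
Variable T : normal_triple.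
Implicit Types g h k : T.
Local Open Scope ring_scope.
Local Notation D d := (dlcsT T (dx d) (dy d)).

(* The bracket of homogeneous components induced by the group commutator,
   with values in degree d; it is 0 unless e + e' = d. *)
Definition hbr (e e' d : N2p) (u : barK T e) (v : barK T e') : barK T d :=
  if is_dsum e e' d then cls d (comm (rep u) (rep v)) else 0.

Lemma dsum_in e e' d g h :
  is_dsum e e' d -> D e g -> D e' h -> D d (comm g h).
Proof. by move=> /andP[/eqP-> /eqP->]; exact: dlcs_comm. Qed.

Lemma comm_cls_l e e' d g g' h : is_dsum e e' d ->
  D e g -> D e g' -> D e' h -> cls e g = cls e g' ->
  cls d (comm g h) = cls d (comm g' h).
Proof.
move=> ed Dg Dg' Dh /(clsP Dg Dg').
set n := (g^-1 * g')%g => Nn.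
have Dn : D e n by exact: dlcs_gt_le.
have -> : g' = (g * n)%g by rewrite /n mulgA mulgV mul1g.
have DD := dsum_in ed.
rewrite comm_mull clsM; last first.
- exact: DD.
- by apply: nrm_conj; [exact: dlcs_normal|exact: DD].
rewrite (@cls_conj _ _ e) //; last exact: DD.
rewrite [X in _ = X + _]cls_eq0 ?add0r //.
by case/andP: ed => /eqP-> /eqP->; exact: dlcs_comm_gt.
Qed.

Lemma clsC (e e' d : N2p) g h : is_dsum e e' d ->
  D e g -> D e' h -> cls d (comm g h) = - cls d (comm h g).
Proof.
move=> ed Dg Dh; rewrite -commK clsV // -commK.
by apply: (subV (@dlcs_sub _ _ _)); exact: dsum_in Dg Dh.
Qed.

Lemma is_dsumC e e' d : is_dsum e e' d = is_dsum e' e d.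
Proof. by rewrite /is_dsum addnC [(dy e + _)%N]addnC. Qed.

Lemma comm_cls_r e e' d g h h' : is_dsum e e' d ->
  D e g -> D e' h -> D e' h' -> cls e' h = cls e' h' ->
  cls d (comm g h) = cls d (comm g h').
Proof.
move=> ed Dg Dh Dh' E; rewrite (clsC ed) // [RHS](clsC ed) //.
by congr (- _); apply: (@comm_cls_l e' e); rewrite // is_dsumC.
Qed.

Lemma hbr_cls e e' d g h : is_dsum e e' d -> D e g -> D e' h ->
  hbr d (cls e g) (cls e' h) = cls d (comm g h).
Proof.
move=> ed Dg Dh; rewrite /hbr ed.
rewrite (@comm_cls_l e e' d _ g) ?repK //; try exact: rep_in.
by rewrite (@comm_cls_r e e' d _ _ h) ?repK //; exact: rep_in.
Qed.

Lemma hbr_out e e' d (u : barK T e) (v : barK T e') :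
  is_dsum e e' d = false -> hbr d u v = 0.
Proof. by rewrite /hbr => ->. Qed.

Lemma hbrDl e e' d (u v : barK T e) (w : barK T e') :
  hbr d (u + v) w = hbr d u w + hbr d v w.
Proof.
have [ed|/negbTE ed] := boolP (is_dsum e e' d); last first.
  by rewrite !hbr_out // addr0.
have [[Du Dv] Dw] := (rep_in u, rep_in v, rep_in w).
rewrite -[u]repK -[v]repK -[w]repK -clsM // !hbr_cls //; last first.
  exact: (subM (@dlcs_sub _ _ _)).
have DD := dsum_in ed.
rewrite comm_mull clsM; last first.
- exact: DD.
- by apply: nrm_conj; [exact: dlcs_normal|exact: DD].
by rewrite (@cls_conj _ _ e) 1?addrC //; exact: DD.
Qed.

Lemma hbrC e e' d (u : barK T e) (v : barK T e') : hbr d u v = - hbr d v u.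
Proof.
rewrite /hbr is_dsumC; case: ifP => [|_]; last by rewrite oppr0.
by rewrite is_dsumC => ed; apply: (clsC ed); exact: rep_in.
Qed.

Lemma hbrDr e e' d (w : barK T e) (u v : barK T e') :
  hbr d w (u + v) = hbr d w u + hbr d w v.
Proof. by rewrite hbrC hbrDl opprD -!hbrC. Qed.

Lemma hbr0l e e' d (v : barK T e') : hbr d (0 : barK T e) v = 0.
Proof. by apply: (@addrI _ (hbr d (0 : barK T e) v)); rewrite -hbrDl !addr0. Qed.

Lemma hbr0r e e' d (v : barK T e') : hbr d v (0 : barK T e) = 0.
Proof. by rewrite hbrC hbr0l oppr0. Qed.

Lemma hbrNl e e' d (u : barK T e) (v : barK T e') :
  hbr d (- u) v = - hbr d u v.
Proof. by apply/eqP; rewrite -addr_eq0 -hbrDl addNr hbr0l. Qed.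

Lemma hbrxx e d (u : barK T e) : hbr d u u = 0.
Proof. by rewrite /hbr commgg cls1; case: ifP. Qed.

Lemma hbr_suml e e' d I (r : seq I) (F : I -> barK T e) (v : barK T e') :
  hbr d (\sum_(i <- r) F i) v = \sum_(i <- r) hbr d (F i) v.
Proof.
by apply: (big_morph (fun u => hbr d u v)) => [u w|]; rewrite ?hbrDl ?hbr0l.
Qed.

Lemma hbr_sumr e e' d I (r : seq I) (v : barK T e') (F : I -> barK T e) :
  hbr d v (\sum_(i <- r) F i) = \sum_(i <- r) hbr d v (F i).
Proof.
by apply: (big_morph (hbr d v)) => [u w|]; rewrite ?hbrDr ?hbr0r.
Qed.

(* The triple bracket [u, [v, w]] with values in degree d. *)
Definition hbr3 (a b c d : N2p) (u : barK T a) (v : barK T b) (w : barK T c) :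
    barK T d :=
  \sum_(f <- N2p_le d) hbr d u (hbr f v w).

Definition dadd (e e' : N2p) : N2p := insubd e (dx e + dx e', dy e + dy e')%N.

Lemma daddE e e' : val (dadd e e') = (dx e + dx e', dy e + dy e')%N.
Proof.
rewrite insubdK //; case: e => -[[|m] [|n]] //= i; apply/eqP => -[].
  by move=> _; rewrite /dy /= addSn.
Qed.

Lemma dx_dadd e e' : dx (dadd e e') = (dx e + dx e')%N.
Proof. by rewrite /dx daddE. Qed.
Lemma dy_dadd e e' : dy (dadd e e') = (dy e + dy e')%N.
Proof. by rewrite /dy daddE. Qed.

Lemma is_dsumP e e' d : is_dsum e e' d = (d == dadd e e').
Proof.
rewrite -val_eqE daddE /is_dsum /dx /dy.
by case: d => -[m n] i /=; rewrite xpair_eqE.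
Qed.

Lemma dsum_dadd e e' : is_dsum e e' (dadd e e').
Proof. by rewrite is_dsumP. Qed.

Lemma N2p_le_uniq d : uniq (N2p_le d).
Proof.
apply: (@pmap_uniq _ _ _ val); first exact: insubK.
by apply: allpairs_uniq; rewrite ?iota_uniq // => -[? ?] [? ?] _ _ [-> ->].
Qed.

Lemma hbr3E a b c d (u : barK T a) (v : barK T b) (w : barK T c) :
  hbr3 d u v w = hbr d u (hbr (dadd b c) v w).
Proof.
rewrite /hbr3; have [H|H] := boolP (dadd b c \in N2p_le d).
  rewrite (bigD1_seq (dadd b c)) ?N2p_le_uniq //= big1 ?addr0 // => f nf.
  by rewrite (@hbr_out b c f) ?hbr0r // is_dsumP; exact/negbTE.
rewrite [RHS]hbr_out.
  rewrite big_seq big1 // => f fd; rewrite (@hbr_out b c f) ?hbr0r //.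
  by rewrite is_dsumP; apply: contraNF H => /eqP<-.
apply: contraNF H; rewrite mem_N2p_le => /andP[/eqP-> /eqP->].
by rewrite !leq_addl.
Qed.

Lemma hbr3_jacobi a b c d (u : barK T a) (v : barK T b) (w : barK T c) :
  hbr3 d u v w + hbr3 d v w u + hbr3 d w u v = 0.
Proof.
rewrite !hbr3E.
have [H1|/negbTE H1] := boolP (is_dsum a (dadd b c) d); last first.
  rewrite !hbr_out ?addr0 //.
  - move: H1; rewrite /is_dsum !dx_dadd !dy_dadd addnA [in X in _ && X]addnA.
    by rewrite [(_ + dx c)%N]addnC [(_ + dy c)%N]addnC.
  - move: H1; rewrite /is_dsum !dx_dadd !dy_dadd.
    by rewrite [(dx a + _)%N]addnC [(dy a + _)%N]addnC -!addnA.
have H2 : is_dsum b (dadd c a) d.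
  move: H1; rewrite /is_dsum !dx_dadd !dy_dadd.
  by rewrite [(dx a + _)%N]addnC [(dy a + _)%N]addnC -!addnA.
have H3 : is_dsum c (dadd a b) d.
  move: H1; rewrite /is_dsum !dx_dadd !dy_dadd addnA [in X in _ && X]addnA.
  by rewrite [(_ + dx c)%N]addnC [(_ + dy c)%N]addnC.
have [[Du Dv] Dw] := (rep_in u, rep_in v, rep_in w).
rewrite -[u]repK -[v]repK -[w]repK.
set g := rep u in Du *; set h := rep v in Dv *; set k := rep w in Dw *.
have key e e' f (x y z : T) : D e x -> D e' y -> D f z ->
    is_dsum f (dadd e e') d ->
  D d (comm (comm x y) (y * z * y^-1)%g) /\
  hbr d (cls f z) (hbr (dadd e e') (cls e x) (cls e' y)) =
    - cls d (comm (comm x y) (y * z * y^-1)%g).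
  move=> Dx Dy Dz fd.
  have Dxy : D (dadd e e') (comm x y) by exact: dsum_in (dsum_dadd e e') Dx Dy.
  have Dzy : D f (y * z * y^-1)%g by apply: nrm_conj => //; exact: dlcs_normal.
  have fd' : is_dsum (dadd e e') f d by rewrite is_dsumC.
  split; first exact: dsum_in fd' Dxy Dzy.
  rewrite hbrC (hbr_cls (dsum_dadd e e')) // -(cls_conj Dy Dz).
  by rewrite (hbr_cls fd').
have [D1 E1] := key _ _ _ h k g Dv Dw Du H1.
have [D2 E2] := key _ _ _ k g h Dw Du Dv H2.
have [D3 E3] := key _ _ _ g h k Du Dv Dw H3.
rewrite E1 E2 E3 -!opprD -[RHS]oppr0 -[in RHS]cls1 -(hall_witt g h k).
have sD := @dlcs_sub T (dx d) (dy d).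
rewrite (clsM (subM sD D3 D1) D2) (clsM D3 D1); congr (- _).
by rewrite -[RHS]addrA [RHS]addrC.
Qed.

End Bracket.

Section AssociatedGradedLieRing.
Variable T : normal_triple.
Local Open Scope ring_scope.

Definition fin_support (f : forall d, barK T d) :=
  exists s : seq N2p, forall d, d \notin s -> f d = 0.

(* The direct sum of the groups barK T d, as finitely supported families. *)
Definition grK := {f : forall d, barK T d | `[< fin_support f >]}.
HB.instance Definition _ := Choice.on grK.

Implicit Types u v w : grK.

Definition grK_coef u : forall d, barK T d := val u.
Local Coercion grK_coef : grK >-> Funclass.

Lemma grK_ext u v : (forall d, u d = v d) -> u = v.
Proof. by move=> E; apply/val_inj/functional_extensionality_dep. Qed.

Definition mk_grK f (fP : fin_support f) : grK := Sub f (asboolT fP).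

Lemma grK_supp u : fin_support u.
Proof. exact: asboolW (valP u). Qed.

Lemma grK_zero_subproof : fin_support (fun d => 0).
Proof. by exists [::]. Qed.
Definition grK_zero := mk_grK grK_zero_subproof.

Lemma grK_opp_subproof u : fin_support (fun d => - u d).
Proof. by have [s us] := grK_supp u; exists s => d ds; rewrite us ?oppr0. Qed.
Definition grK_opp u := mk_grK (grK_opp_subproof u).

Lemma grK_add_subproof u v : fin_support (fun d => u d + v d).
Proof.
have [s us] := grK_supp u; have [t vt] := grK_supp v.
exists (s ++ t) => d; rewrite mem_cat negb_or => /andP[ds dt].
by rewrite us ?vt ?addr0.
Qed.
Definition grK_add u v := mk_grK (grK_add_subproof u v).

Lemma grK_addA : associative grK_add.
Proof. by move=> u v w; apply: grK_ext => d; exact: addrA. Qed.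
Lemma grK_addC : commutative grK_add.
Proof. by move=> u v; apply: grK_ext => d; exact: addrC. Qed.
Lemma grK_add0 : left_id grK_zero grK_add.
Proof. by move=> u; apply: grK_ext => d; exact: add0r. Qed.
Lemma grK_addN : left_inverse grK_zero grK_opp grK_add.
Proof. by move=> u; apply: grK_ext => d; exact: addNr. Qed.

HB.instance Definition _ :=
  GRing.isZmodule.Build grK grK_addA grK_addC grK_add0 grK_addN.

Lemma grK_coefD u v d : grK_coef (u + v) d = u d + v d. Proof. by []. Qed.
Lemma grK_coef0 d : grK_coef 0 d = 0. Proof. by []. Qed.

(* The sum runs over all (e, e') below d; the terms with e + e' <> d are 0. *)
Definition grK_br_fun u v d : barK T d :=
  \sum_(e <- N2p_le d) \sum_(e' <- N2p_le d) hbr d (u e) (v e').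

Lemma grK_br_subproof u v : fin_support (grK_br_fun u v).
Proof.
have [s us] := grK_supp u; have [t vt] := grK_supp v.
exists [seq dadd e e' | e <- s, e' <- t] => d dst.
rewrite /grK_br_fun big1 // => e _; rewrite big1 // => e' _.
have [es|/us->] := boolP (e \in s); last by rewrite hbr0l.
have [et|/vt->] := boolP (e' \in t); last by rewrite hbr0r.
rewrite hbr_out // is_dsumP; apply: contraNF dst => /eqP->.
exact: allpairs_f.
Qed.
Definition grK_br u v : grK := mk_grK (grK_br_subproof u v).

Lemma grK_brE u v d :
  (grK_br u v) d = \sum_(e <- N2p_le d) \sum_(e' <- N2p_le d) hbr d (u e) (v e').
Proof. by []. Qed.

Lemma grK_brDl u v w : grK_br (u + v) w = grK_br u w + grK_br v w.
Proof.
apply: grK_ext => d; rewrite grK_coefD !grK_brE -big_split /=.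
apply: eq_bigr => e _; rewrite -big_split /=; apply: eq_bigr => e' _.
exact: hbrDl.
Qed.

Lemma grK_brDr u v w : grK_br u (v + w) = grK_br u v + grK_br u w.
Proof.
apply: grK_ext => d; rewrite grK_coefD !grK_brE -big_split /=.
apply: eq_bigr => e _; rewrite -big_split /=; apply: eq_bigr => e' _.
exact: hbrDr.
Qed.

Lemma sum_alternating (V : zmodType) (I : Type) (r : seq I) (F : I -> I -> V) :
  (forall i, F i i = 0) -> (forall i j, F i j = - F j i) ->
  \sum_(i <- r) \sum_(j <- r) F i j = 0.
Proof.
move=> F0 FN; elim: r => [|x r IH]; first by rewrite big_nil.
rewrite big_cons big_cons F0 add0r.
under [X in _ + X]eq_bigr do rewrite big_cons.
rewrite big_split /= IH addr0 -big_split /= big1 // => i _.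
by rewrite FN addNr.
Qed.

Lemma grK_brxx u : grK_br u u = 0.
Proof.
apply: grK_ext => d; rewrite grK_brE.
by apply: sum_alternating => [e|e e']; [exact: hbrxx|exact: hbrC].
Qed.

Lemma hbr_sum_le (e d d' : N2p) (x : barK T e) v w :
  d' \in N2p_le d ->
  hbr d x ((grK_br v w) d') =
  \sum_(a <- N2p_le d) \sum_(b <- N2p_le d) hbr d x (hbr d' (v a) (w b)).
Proof.
move=> d'd; have widen (V : zmodType) (F : N2p -> V) :
    (forall a, a \notin N2p_le d' -> F a = 0) ->
    \sum_(a <- N2p_le d') F a = \sum_(a <- N2p_le d) F a.
  move=> F0; rewrite [RHS](bigID (mem (N2p_le d'))) /= [X in _ + X]big1 // addr0.
  rewrite -[RHS]big_filter; apply: perm_big; apply: uniq_perm.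
  - exact: N2p_le_uniq.
  - by rewrite filter_uniq // N2p_le_uniq.
  move=> a; rewrite mem_filter; case: (boolP (a \in N2p_le d')) => //= ad'.
  move: ad' d'd; rewrite !mem_N2p_le => /andP[a1 a2] /andP[b1 b2].
  by rewrite (leq_trans a1) // (leq_trans a2).
rewrite grK_brE hbr_sumr widen => [|a ad'].
  apply: eq_bigr => a _; rewrite hbr_sumr widen // => b bd'.
  rewrite (@hbr_out _ a b) ?hbr0r //; apply: contraNF bd'.
  by rewrite mem_N2p_le => /andP[/eqP-> /eqP->]; rewrite !leq_addl.
rewrite hbr_sumr big1 // => b _.
rewrite (@hbr_out _ a b) ?hbr0r //; apply: contraNF ad'.
by rewrite mem_N2p_le => /andP[/eqP-> /eqP->]; rewrite !leq_addr.
Qed.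

Lemma grK_br3E u v w d :
  (grK_br u (grK_br v w)) d =
  \sum_(a <- N2p_le d) \sum_(b <- N2p_le d) \sum_(c <- N2p_le d)
    hbr3 d (u a) (v b) (w c).
Proof.
rewrite grK_brE; apply: eq_bigr => a _.
under eq_big_seq => f fd do rewrite hbr_sum_le //.
rewrite exchange_big /=; apply: eq_bigr => b _.
by rewrite exchange_big.
Qed.

Lemma grK_jacobi u v w :
  grK_br u (grK_br v w) + grK_br v (grK_br w u) + grK_br w (grK_br u v) = 0.
Proof.
apply: grK_ext => d; rewrite !grK_coefD !grK_br3E.
rewrite [X in _ + X + _](_ : _ = \sum_(a <- N2p_le d) \sum_(b <- N2p_le d)
    \sum_(c <- N2p_le d) hbr3 d (v b) (w c) (u a)); last first.
  rewrite [RHS]exchange_big; apply: eq_bigr => b _.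
  by rewrite [RHS]exchange_big.
rewrite [X in _ + _ + X](_ : _ = \sum_(a <- N2p_le d) \sum_(b <- N2p_le d)
    \sum_(c <- N2p_le d) hbr3 d (w c) (u a) (v b)); last first.
  rewrite exchange_big; apply: eq_bigr => a _.
  by rewrite exchange_big.
rewrite -!big_split big1 // => a _; rewrite -!big_split big1 // => b _.
by rewrite -!big_split big1 // => c _; exact: hbr3_jacobi.
Qed.

HB.instance Definition _ :=
  Zmodule_isLieRing.Build grK grK_brDl grK_brDr grK_brxx grK_jacobi.

Definition grK_deg (d : N2p) : set grK :=
  [set u | forall e, e != d -> u e = 0].

Definition grK_in_fun (d : N2p) (x : barK T d) : forall e, barK T e :=
  dfwith (fun e => 0) x.

Lemma grK_in_subproof d (x : barK T d) : fin_support (grK_in_fun x).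
Proof.
exists [:: d] => e; rewrite inE => ed.
by rewrite /grK_in_fun dfwith_out // eq_sym.
Qed.
Definition grK_in d (x : barK T d) : grK := mk_grK (grK_in_subproof x).

Lemma grK_inE d (x : barK T d) : grK_in x d = x.
Proof. exact: dfwith_in. Qed.

Lemma grK_in_out d e (x : barK T d) : e != d -> grK_in x e = 0.
Proof.
by move=> ed; rewrite /grK_in /grK_coef /= /grK_in_fun dfwith_out // eq_sym.
Qed.

Lemma grK_in_cls_br (e e' : N2p) (g h : T) :
  dlcsT T (dx e) (dy e) g -> dlcsT T (dx e') (dy e') h ->
  lbr (grK_in (cls e g)) (grK_in (cls e' h)) =
  grK_in (cls (dadd e e') (comm g h)).
Proof.
move=> Dg Dh; apply: grK_ext => d.
rewrite [LHS]grK_brE.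
have [->|nd] := eqVneq d (dadd e e'); last first.
  rewrite grK_in_out // big1 // => a _; rewrite big1 // => b _.
  have [ae|ae] := eqVneq a e; last by rewrite (grK_in_out _ ae) hbr0l.
  have [be|be] := eqVneq b e'; last by rewrite (grK_in_out _ be) hbr0r.
  by rewrite hbr_out // is_dsumP ae be; exact/negbTE.
rewrite grK_inE (bigD1_seq e) ?N2p_le_uniq //=; last first.
  by rewrite mem_N2p_le dx_dadd dy_dadd !leq_addr.
rewrite [X in _ + X]big1 ?addr0 => [|a ae]; last first.
  by rewrite big1 // => b _; rewrite (grK_in_out _ ae) hbr0l.
rewrite (bigD1_seq e') ?N2p_le_uniq //=; last first.
  by rewrite mem_N2p_le dx_dadd dy_dadd !leq_addl.
rewrite big1 ?addr0 => [|b be]; last by rewrite (grK_in_out _ be) hbr0r.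
by rewrite !grK_inE hbr_cls ?dsum_dadd.
Qed.

End AssociatedGradedLieRing.

(* The free group on S: words in the letters (s, true), standing for s, and
   (s, false), standing for s^-1, modulo the congruence generated by the
   cancellation of adjacent inverse letters. *)
Section FreeGroup.
Variable S : choiceType.
Local Open Scope group_scope.

Definition fg_word := seq (S * bool).
HB.instance Definition _ := Choice.on fg_word.

Implicit Types w : fg_word.

Inductive fg_eq : fg_word -> fg_word -> Prop :=
| FgCancel w1 w2 s b : fg_eq (w1 ++ [:: (s, b), (s, ~~ b) & w2]) (w1 ++ w2)
| FgRefl w : fg_eq w w
| FgSym w1 w2 : fg_eq w1 w2 -> fg_eq w2 w1
| FgTrans w1 w2 w3 : fg_eq w1 w2 -> fg_eq w2 w3 -> fg_eq w1 w3.

Definition fg_rel w1 w2 : bool := `[< fg_eq w1 w2 >].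

Lemma fg_rel_refl : reflexive fg_rel.
Proof. by move=> w; apply/asboolP; exact: FgRefl. Qed.
Lemma fg_rel_sym : symmetric fg_rel.
Proof. by move=> w1 w2; apply/asboolP/asboolP => /FgSym. Qed.
Lemma fg_rel_trans : transitive fg_rel.
Proof.
by move=> w2 w1 w3 /asboolP H1 /asboolP H2; apply/asboolP; exact: FgTrans H2.
Qed.

Canonical fg_rel_equiv := EquivRel fg_rel fg_rel_refl fg_rel_sym fg_rel_trans.

Definition free_group := {eq_quot fg_rel}.
HB.instance Definition _ := Choice.on free_group.
HB.instance Definition _ := EqQuotient.on free_group.

Definition fg_winv w : fg_word := rev [seq (l.1, ~~ l.2) | l <- w].

Lemma fg_eqP w1 w2 : \pi_free_group w1 = \pi_free_group w2 <-> fg_eq w1 w2.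
Proof.
split=> [/eqmodP /asboolP //|H].
by apply/eqmodP/asboolP.
Qed.

Lemma fg_reprK w : fg_eq (repr (\pi_free_group w)) w.
Proof. by apply/fg_eqP; rewrite reprK. Qed.

Lemma fg_eq_catl w w1 w2 : fg_eq w1 w2 -> fg_eq (w ++ w1) (w ++ w2).
Proof.
elim=> {w1 w2} [w1 w2 s b|w1|w1 w2 _ H|w1 w2 w3 _ H1 _ H2].
- by rewrite !catA; exact: FgCancel.
- exact: FgRefl.
- exact: FgSym.
- exact: FgTrans H2.
Qed.

Lemma fg_eq_catr w w1 w2 : fg_eq w1 w2 -> fg_eq (w1 ++ w) (w2 ++ w).
Proof.
elim=> {w1 w2} [w1 w2 s b|w1|w1 w2 _ H|w1 w2 w3 _ H1 _ H2].
- by rewrite -!catA; exact: FgCancel.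
- exact: FgRefl.
- exact: FgSym.
- exact: FgTrans H2.
Qed.

Lemma fg_eq_inv w1 w2 : fg_eq w1 w2 -> fg_eq (fg_winv w1) (fg_winv w2).
Proof.
elim=> {w1 w2} [w1 w2 s b|w1|w1 w2 _ H|w1 w2 w3 _ H1 _ H2].
- rewrite /fg_winv !map_cat !rev_cat /= !rev_cons -!cats1 -!catA /= negbK.
  by have := FgCancel (fg_winv w2) (fg_winv w1) s b.
- exact: FgRefl.
- exact: FgSym.
- exact: FgTrans H2.
Qed.

Lemma fg_winvK w : fg_winv (fg_winv w) = w.
Proof.
rewrite /fg_winv map_rev revK -map_comp -[RHS]map_id.
by apply: eq_map => -[s b] /=; rewrite negbK.
Qed.

Lemma fg_eq_invr w : fg_eq (w ++ fg_winv w) [::].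
Proof.
elim: w => [|[s b] w IH]; first exact: FgRefl.
rewrite /fg_winv /= rev_cons -cats1 catA.
apply: FgTrans (FgCancel [::] [::] s b).
rewrite (_ : [:: (s, b), (s, ~~ b) & [::]] =
  [:: (s, b)] ++ [::] ++ [:: (s, ~~ b)]) //.
by apply: (@fg_eq_catl [:: (s, b)]); exact: fg_eq_catr.
Qed.

Definition fg_mul (g h : free_group) : free_group := \pi_free_group (repr g ++ repr h).
Definition fg_one : free_group := \pi_free_group [::].
Definition fg_inv (g : free_group) : free_group := \pi_free_group (fg_winv (repr g)).

Lemma fg_mul_pi w1 w2 :
  fg_mul (\pi_free_group w1) (\pi_free_group w2) = \pi_free_group (w1 ++ w2).
Proof.
apply/fg_eqP; apply: FgTrans (fg_eq_catl _ (fg_reprK w2)).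
exact: fg_eq_catr (fg_reprK w1).
Qed.

Lemma fg_inv_pi w : fg_inv (\pi_free_group w) = \pi_free_group (fg_winv w).
Proof. by apply/fg_eqP/fg_eq_inv; exact: fg_reprK. Qed.

Lemma fg_mulA : associative fg_mul.
Proof.
by elim/quotW=> x; elim/quotW=> y; elim/quotW=> z;
  rewrite (fg_mul_pi y z) (fg_mul_pi x y) !fg_mul_pi catA.
Qed.
Lemma fg_mul1 : left_id fg_one fg_mul.
Proof. by elim/quotW=> x; rewrite fg_mul_pi. Qed.
Lemma fg_mulr1 : right_id fg_one fg_mul.
Proof. by elim/quotW=> x; rewrite fg_mul_pi cats0. Qed.
Lemma fg_mulrV : right_inverse fg_one fg_inv fg_mul.
Proof.
by elim/quotW=> x; rewrite fg_inv_pi fg_mul_pi; apply/fg_eqP/fg_eq_invr.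
Qed.
Lemma fg_mulV : left_inverse fg_one fg_inv fg_mul.
Proof.
elim/quotW=> x; rewrite fg_inv_pi fg_mul_pi -{2}[x]fg_winvK.
by apply/fg_eqP/fg_eq_invr.
Qed.

HB.instance Definition _ :=
  isGroup.Build free_group fg_mulA fg_mul1 fg_mulr1 fg_mulV fg_mulrV.

Definition fg_gen (s : S) : free_group := \pi_free_group [:: (s, true)].

Section Lift.
Variables (H : groupType) (f : S -> H).

Fixpoint fg_eval w : H :=
  if w is (s, b) :: w' then (if b then f s else (f s)^-1) * fg_eval w' else 1.

Definition fg_lift (g : free_group) : H := fg_eval (repr g).

Lemma fg_eval_cat w1 w2 : fg_eval (w1 ++ w2) = fg_eval w1 * fg_eval w2.
Proof.
by elim: w1 => [|[s b] w1 IH] /=; rewrite ?mul1g // IH mulgA.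
Qed.

Lemma fg_eval_eq w1 w2 : fg_eq w1 w2 -> fg_eval w1 = fg_eval w2.
Proof.
elim=> {w1 w2} [w1 w2 s b|//|//|w1 w2 w3 _ -> _ -> //].
by rewrite !fg_eval_cat /= !mulgA; case: b; rewrite /= ?mulgK ?mulgVK.
Qed.

Lemma fg_lift_pi w : fg_lift (\pi_free_group w) = fg_eval w.
Proof. exact: fg_eval_eq (fg_reprK w). Qed.

Lemma fg_liftM : {morph fg_lift : g h / g * h}.
Proof.
elim/quotW=> x; elim/quotW=> y.
by rewrite [_ * _]fg_mul_pi !fg_lift_pi fg_eval_cat.
Qed.

Lemma fg_lift_gen s : fg_lift (fg_gen s) = f s.
Proof. by rewrite fg_lift_pi /= mulg1. Qed.

Lemma fg_lift_unique (h : free_group -> H) :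
  {morph h : x y / x * y} -> (forall s, h (fg_gen s) = f s) -> h =1 fg_lift.
Proof.
move=> hM hf; have h1 : h 1 = 1.
  by apply: (mulgI (h 1)); rewrite -hM !mulg1.
elim/quotW=> w; rewrite fg_lift_pi; elim: w => [|[s b] w IH] //=.
rewrite -cat1s -[\pi_free_group _]fg_mul_pi hM IH; congr (_ * _).
case: b; first exact: hf.
apply: (mulgI (f s)); rewrite mulgV -hf -hM -h1; congr h.
by rewrite [LHS]fg_mul_pi; apply/fg_eqP; exact: (FgCancel [::] [::] s true).
Qed.

End Lift.
End FreeGroup.

(* The free Lie algebra over the integers on S: terms in the operations of a
   Lie algebra over the generators S, modulo the congruence generated by the
   axioms of a Lie algebra. *)
Inductive lie_term (S : Type) : Type :=
| LVar of S
| LZero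
| LOpp of lie_term S
| LAdd of lie_term S & lie_term S
| LBr of lie_term S & lie_term S.
Arguments LZero {S}.

Section FreeLie.
Variable S : Type.
Implicit Types a b c : lie_term S.
Local Open Scope ring_scope.

HB.instance Definition _ := gen_eqMixin (lie_term S).
HB.instance Definition _ := gen_choiceMixin (lie_term S).

Inductive lie_eq : lie_term S -> lie_term S -> Prop :=
| LieRefl a : lie_eq a a
| LieSym a b : lie_eq a b -> lie_eq b a
| LieTrans a b c : lie_eq a b -> lie_eq b c -> lie_eq a c
| LieOppCongr a a' : lie_eq a a' -> lie_eq (LOpp a) (LOpp a')
| LieAddCongr a a' b b' :
    lie_eq a a' -> lie_eq b b' -> lie_eq (LAdd a b) (LAdd a' b')
| LieBrCongr a a' b b' :
    lie_eq a a' -> lie_eq b b' -> lie_eq (LBr a b) (LBr a' b')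
| LieAddA a b c : lie_eq (LAdd a (LAdd b c)) (LAdd (LAdd a b) c)
| LieAddC a b : lie_eq (LAdd a b) (LAdd b a)
| LieAdd0 a : lie_eq (LAdd LZero a) a
| LieAddN a : lie_eq (LAdd (LOpp a) a) LZero
| LieBrDl a b c : lie_eq (LBr (LAdd a b) c) (LAdd (LBr a c) (LBr b c))
| LieBrDr a b c : lie_eq (LBr a (LAdd b c)) (LAdd (LBr a b) (LBr a c))
| LieBrxx a : lie_eq (LBr a a) LZero
| LieJacobi a b c :
    lie_eq (LAdd (LAdd (LBr a (LBr b c)) (LBr b (LBr c a))) (LBr c (LBr a b)))
           LZero.

Definition lie_rel a b : bool := `[< lie_eq a b >].

Lemma lie_rel_refl : reflexive lie_rel.
Proof. by move=> w; apply/asboolP; exact: LieRefl. Qed.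
Lemma lie_rel_sym : symmetric lie_rel.
Proof. by move=> w1 w2; apply/asboolP/asboolP => /LieSym. Qed.
Lemma lie_rel_trans : transitive lie_rel.
Proof.
by move=> w2 w1 w3 /asboolP H1 /asboolP H2; apply/asboolP; exact: LieTrans H2.
Qed.

Canonical lie_rel_equiv :=
  EquivRel lie_rel lie_rel_refl lie_rel_sym lie_rel_trans.

Definition free_lie := {eq_quot lie_rel}.
HB.instance Definition _ := Choice.on free_lie.
HB.instance Definition _ := EqQuotient.on free_lie.

Lemma lie_eqP a b : \pi_free_lie a = \pi_free_lie b <-> lie_eq a b.
Proof.
split=> [/eqmodP /asboolP //|H].
by apply/eqmodP/asboolP.
Qed.

Lemma lie_reprK a : lie_eq (repr (\pi_free_lie a)) a.
Proof. by apply/lie_eqP; rewrite reprK. Qed.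

Definition fl_zero : free_lie := \pi_free_lie LZero.
Definition fl_opp (u : free_lie) : free_lie := \pi_free_lie (LOpp (repr u)).
Definition fl_add (u v : free_lie) : free_lie := \pi_free_lie (LAdd (repr u) (repr v)).
Definition fl_br (u v : free_lie) : free_lie := \pi_free_lie (LBr (repr u) (repr v)).

Lemma fl_opp_pi a : fl_opp (\pi_free_lie a) = \pi_free_lie (LOpp a).
Proof. by apply/lie_eqP/LieOppCongr/lie_reprK. Qed.
Lemma fl_add_pi a b : fl_add (\pi_free_lie a) (\pi_free_lie b) = \pi_free_lie (LAdd a b).
Proof. by apply/lie_eqP; apply: LieAddCongr; exact: lie_reprK. Qed.
Lemma fl_br_pi a b : fl_br (\pi_free_lie a) (\pi_free_lie b) = \pi_free_lie (LBr a b).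
Proof. by apply/lie_eqP; apply: LieBrCongr; exact: lie_reprK. Qed.

Lemma fl_addA : associative fl_add.
Proof.
elim/quotW=> a; elim/quotW=> b; elim/quotW=> c.
rewrite (fl_add_pi b c) (fl_add_pi a b) !fl_add_pi.
exact/lie_eqP/LieAddA.
Qed.
Lemma fl_addC : commutative fl_add.
Proof.
by elim/quotW=> a; elim/quotW=> b; rewrite !fl_add_pi; exact/lie_eqP/LieAddC.
Qed.
Lemma fl_add0 : left_id fl_zero fl_add.
Proof. by elim/quotW=> a; rewrite fl_add_pi; exact/lie_eqP/LieAdd0. Qed.
Lemma fl_addN : left_inverse fl_zero fl_opp fl_add.
Proof.
by elim/quotW=> a; rewrite fl_opp_pi fl_add_pi; exact/lie_eqP/LieAddN.
Qed.

HB.instance Definition _ :=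
  GRing.isZmodule.Build free_lie fl_addA fl_addC fl_add0 fl_addN.

Lemma fl_brDl u v w : fl_br (u + v) w = fl_br u w + fl_br v w.
Proof.
elim/quotW: u => a; elim/quotW: v => b; elim/quotW: w => c.
rewrite [_ + _ in LHS]fl_add_pi [RHS]/GRing.add /= !fl_br_pi fl_add_pi.
exact/lie_eqP/LieBrDl.
Qed.
Lemma fl_brDr u v w : fl_br u (v + w) = fl_br u v + fl_br u w.
Proof.
elim/quotW: u => a; elim/quotW: v => b; elim/quotW: w => c.
rewrite [_ + _ in LHS]fl_add_pi [RHS]/GRing.add /= !fl_br_pi fl_add_pi.
exact/lie_eqP/LieBrDr.
Qed.
Lemma fl_brxx u : fl_br u u = 0.
Proof. by elim/quotW: u => a; rewrite fl_br_pi; exact/lie_eqP/LieBrxx. Qed.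
Lemma fl_jacobi u v w :
  fl_br u (fl_br v w) + fl_br v (fl_br w u) + fl_br w (fl_br u v) = 0.
Proof.
elim/quotW: u => a; elim/quotW: v => b; elim/quotW: w => c.
rewrite (fl_br_pi b c) (fl_br_pi c a) (fl_br_pi a b) (fl_br_pi a) (fl_br_pi b).
rewrite (fl_br_pi c) [X in X + _]fl_add_pi [LHS]fl_add_pi.
exact/lie_eqP/LieJacobi.
Qed.

HB.instance Definition _ :=
  Zmodule_isLieRing.Build free_lie fl_brDl fl_brDr fl_brxx fl_jacobi.

Definition fl_gen (s : S) : free_lie := \pi_free_lie (LVar s).

Section Lift.
Variables (L : lieRingType) (f : S -> L).

Fixpoint lie_eval a : L :=
  match a with
  | LVar s => f s
  | LZero => 0
  | LOpp a => - lie_eval a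
  | LAdd a b => lie_eval a + lie_eval b
  | LBr a b => lbr (lie_eval a) (lie_eval b)
  end.

Definition lie_lift (u : free_lie) : L := lie_eval (repr u).

Lemma lie_eval_eq a b : lie_eq a b -> lie_eval a = lie_eval b.
Proof.
elim=> {a b} //=.
- by move=> a b c _ -> _ ->.
- by move=> a a' _ ->.
- by move=> a a' b b' _ -> _ ->.
- by move=> a a' b b' _ -> _ ->.
- by move=> a b c; exact: addrA.
- by move=> a b; exact: addrC.
- by move=> a; exact: add0r.
- by move=> a; exact: addNr.
- by move=> a b c; exact: lbrDl.
- by move=> a b c; exact: lbrDr.
- by move=> a; exact: lbrxx.
- by move=> a b c; exact: lbr_jacobi.
Qed.

Lemma lie_lift_pi a : lie_lift (\pi_free_lie a) = lie_eval a.
Proof. exact: lie_eval_eq (lie_reprK a). Qed.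

Lemma lie_lift_morphism : is_lie_morphism lie_lift.
Proof.
split; elim/quotW=> a; elim/quotW=> b.
  by rewrite [_ + _ in LHS]fl_add_pi !lie_lift_pi.
by rewrite [lbr _ _ in LHS]fl_br_pi !lie_lift_pi.
Qed.

Lemma lie_lift_gen s : lie_lift (fl_gen s) = f s.
Proof. by rewrite lie_lift_pi. Qed.

Lemma lie_lift_unique (h : free_lie -> L) :
  is_lie_morphism h -> (forall s, h (fl_gen s) = f s) -> h =1 lie_lift.
Proof.
case=> hD hB hf; have h0 : h 0 = 0.
  by apply: (addrI (h 0)); rewrite -hD !addr0.
have hN u : h (- u) = - h u.
  by apply/eqP; rewrite -addr_eq0 -hD addNr h0.
elim/quotW=> a; rewrite lie_lift_pi.
elim: a => [s||a IH|a IHa b IHb|a IHa b IHb] //=.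
- exact: hf.
- by rewrite -fl_opp_pi -IH -hN.
- by rewrite -fl_add_pi -IHa -IHb -hD.
- by rewrite -fl_br_pi -IHa -IHb -hB.
Qed.

End Lift.
End FreeLie.

Section BigradedFreeLie.
Variables A B : Type.
Local Open Scope ring_scope.

(* The smallest family of subgroups of the free Lie algebra on the disjoint
   union of A and B which contains A in degree (1, 0), B in degree (0, 1), and
   for which the bracket is additive in degree. *)
Inductive fl_deg : nat -> nat -> set (free_lie (A + B)) :=
| FlDegA a : fl_deg 1 0 (fl_gen (inl a))
| FlDegB b : fl_deg 0 1 (fl_gen (inr b))
| FlDeg0 m n : fl_deg m n 0
| FlDegD m n u v : fl_deg m n u -> fl_deg m n v -> fl_deg m n (u + v)
| FlDegN m n u : fl_deg m n u -> fl_deg m n (- u)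
| FlDegBr m n m' n' u v :
    fl_deg m n u -> fl_deg m' n' v -> fl_deg (m + m') (n + n') (lbr u v).

Definition fl_piece (d : N2p) : set (free_lie (A + B)) := fl_deg (dx d) (dy d).

Definition fl_piece_pred (d : N2p) : {pred free_lie (A + B)} :=
  fun u => `[< fl_piece d u >].

Lemma fl_piece_closed d : zmod_closed (fl_piece_pred d).
Proof.
split=> [|u v /asboolP Hu /asboolP Hv]; apply/asboolP; first exact: FlDeg0.
by apply: FlDegD => //; exact: FlDegN.
Qed.
HB.instance Definition _ d :=
  GRing.isZmodClosed.Build _ (fl_piece_pred d) (fl_piece_closed d).

Definition free_lie_deg (d : N2p) := {u | u \in fl_piece_pred d}.
HB.instance Definition _ d := [isSub of free_lie_deg d for sval].
HB.instance Definition _ d := [Choice of free_lie_deg d by <:].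
HB.instance Definition _ d :=
  [SubChoice_isSubZmodule of free_lie_deg d by <:].

End BigradedFreeLie.


(* When Ldeg or Mdeg is a direct sum decomposition, f transports it to the
   other side. *)
Definition is_graded_lie_iso (L M : lieRingType)
    (Ldeg : N2p -> set L) (Mdeg : N2p -> set M) (f : L -> M) :=
  [/\ is_lie_morphism f, bijective f & forall d, f @` Ldeg d = Mdeg d].

Section FreeTriple.
Variables p q : nat.

Definition fgx (i : 'I_p) : free_group ('I_p + 'I_q)%type := fg_gen (inl i).
Definition fgy (j : 'I_q) : free_group ('I_p + 'I_q)%type := fg_gen (inr j).

Definition free_triple : normal_triple :=
  NormalTriple (normal_closure_normal (range fgx))
               (normal_closure_normal (range fgy)).

Lemma fgx_in i : dlcsT free_triple (dx d10) (dy d10) (fgx i).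
Proof. by apply: sub_normal_closure; exists i. Qed.

Lemma fgy_in j : dlcsT free_triple (dx d01) (dy d01) (fgy j).
Proof. by apply: sub_normal_closure; exists j. Qed.

Definition phi_gen (s : 'I_p + 'I_q) : grK free_triple :=
  match s with
  | inl i => grK_in (cls d10 (fgx i : free_triple))
  | inr j => grK_in (cls d01 (fgy j : free_triple))
  end.

Definition phi : free_lie ('I_p + 'I_q)%type -> grK free_triple :=
  lie_lift phi_gen.

End FreeTriple.

(* Main.v *)
(* The Magnus embedding x |-> 1 + x of the free group into the units of the ring
   of noncommutative power series over the integers sends K_(m, n) into 1 plus
   the ideal of the series whose monomials have bidegree >= (m, n).  Taking the
   component of bidegree (m, n) thus defines a morphism from the graded Lie ring
   of K to the series under the commutator bracket, and its composite with phi
   is the canonical map from the free Lie ring to the series.  The latter is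
   injective: the brackets of the Hall trees attached to the Lyndon words span
   the free Lie ring, and each of them has its Lyndon word as smallest monomial,
   with coefficient 1.  Hence phi is injective.  It is onto since every K_(m, n)
   is generated by commutators of elements of lower degree, down to X and Y,
   whose classes are spanned by those of the generators because conjugation is
   trivial on the graded pieces. *)
Require Import Defs.
From HB Require Import structures.
From mathcomp Require Import all_boot all_order all_algebra ring zify.
From mathcomp Require Import boolp classical_sets.

Set Implicit Arguments.
Unset Strict Implicit.
Unset Printing Implicit Defensive.

Import Order.TTheory GRing.Theory.
Import DefaultSeqLexiOrder.

Local Open Scope quotient_scope.
Local Open Scope ring_scope.

(** * Noncommutative power series over the integers and their commutator bracket *)

Section Commutators.
Variable R : pzRingType.
Implicit Types u v w : R.

Definition rcomm u v := u * v - v * u.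

Lemma rcommDl u v w : rcomm (u + v) w = rcomm u w + rcomm v w.
Proof. by rewrite /rcomm mulrDl mulrDr opprD addrACA. Qed.

Lemma rcommDr u v w : rcomm u (v + w) = rcomm u v + rcomm u w.
Proof. by rewrite /rcomm mulrDr mulrDl opprD addrACA. Qed.

Lemma rcommxx u : rcomm u u = 0.
Proof. exact: subrr. Qed.

Lemma rcomm_jacobi u v w :
  rcomm u (rcomm v w) + rcomm v (rcomm w u) + rcomm w (rcomm u v) = 0.
Proof.
have E x y z : rcomm x (rcomm y z) =
    x * y * z + z * y * x - (y * z * x + x * z * y).
  by rewrite /rcomm mulrBl mulrBr !mulrA !opprB opprD addrACA [- _ - _]addrC.
by rewrite !E !subrKA subrr.
Qed.

End Commutators.

(* Noncommutative formal power series in the letters S, as the families of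
   their coefficients. *)
Definition series (S : Type) := seq S -> int.

Section Series.
Variable S : eqType.
Implicit Types (F G H : series S) (u v w : seq S).

HB.instance Definition _ := gen_eqMixin (series S).
HB.instance Definition _ := gen_choiceMixin (series S).

Definition series_zero : series S := fun=> 0.
Definition series_opp F : series S := fun w => - F w.
Definition series_add F G : series S := fun w => F w + G w.

Fact series_addA : associative series_add.
Proof. by move=> F G H; apply/funext => w; exact: addrA. Qed.
Fact series_addC : commutative series_add.
Proof. by move=> F G; apply/funext => w; exact: addrC. Qed.
Fact series_add0 : left_id series_zero series_add.
Proof. by move=> F; apply/funext => w; exact: add0r. Qed.
Fact series_addN : left_inverse series_zero series_opp series_add.
Proof. by move=> F; apply/funext => w; exact: addNr. Qed.

HB.instance Definition _ := GRing.isZmodule.Build (series S)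
  series_addA series_addC series_add0 series_addN.

(* The sum of F u * G v over all factorizations w = u ++ v. *)
Fixpoint conv F G w : int :=
  F [::] * G w + (if w is a :: w' then conv (fun v => F (a :: v)) G w' else 0).

Lemma convDl F G H w : conv (fun v => F v + G v) H w = conv F H w + conv G H w.
Proof.
elim: w F G => [|a w IH] F G /=; first by rewrite !addr0 mulrDl.
by rewrite IH mulrDl addrACA.
Qed.

Lemma convDr F G H w : conv F (fun v => G v + H v) w = conv F G w + conv F H w.
Proof.
elim: w F => [|a w IH] F /=; first by rewrite !addr0 mulrDr.
by rewrite IH mulrDr addrACA.
Qed.

Lemma convZl (c : int) F G w : conv (fun v => c * F v) G w = c * conv F G w.
Proof. by elim: w F => [|a w IH] F /=; rewrite ?IH; ring. Qed.

Lemma eq_conv F F' G G' w :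
  (forall u v, w = u ++ v -> F u * G v = F' u * G' v) ->
  conv F G w = conv F' G' w.
Proof.
elim: w F F' => [|a w IH] F F' E /=; first by rewrite (E [::] [::] erefl).
rewrite (E [::] (a :: w) erefl); congr (_ + _); apply: IH => u v Ew.
by apply: (E (a :: u) v); rewrite Ew.
Qed.

Lemma conv_eq0 F G w :
  (forall u v, w = u ++ v -> F u * G v = 0) -> conv F G w = 0.
Proof.
elim: w F => [|a w IH] F E /=; first by rewrite (E [::] [::] erefl).
rewrite (E [::] (a :: w) erefl) add0r; apply: IH => u v Ew.
by apply: (E (a :: u) v); rewrite Ew.
Qed.

(** A factorization of [u ++ v] is determined by the length of its left factor, so a single term of
    the sum survives. *)
Lemma conv_split F G u v :
  (forall u' v', u ++ v = u' ++ v' -> size u' != size u -> F u' * G v' = 0) ->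
  conv F G (u ++ v) = F u * G v.
Proof.
elim: u F => [|a u IH] F E /=.
  case: v E => [|a v] E /=; first by rewrite addr0.
  rewrite conv_eq0 ?addr0 // => u' v' E'.
  by apply: (E (a :: u') v'); rewrite //= E'.
rewrite (E [::] (a :: u ++ v)) // add0r; apply: IH => u' v' E' s.
by apply: (E (a :: u') v'); rewrite ?cat_cons ?E'.
Qed.

Lemma convA F G H w : conv F (conv G H) w = conv (conv F G) H w.
Proof.
elim: w F => [|a w IH] F /=; first by rewrite !addr0 mulrA.
by rewrite convDl convZl -IH; ring.
Qed.

Definition series_one : series S := fun w => (w == [::])%:R.

Lemma conv1s F w : conv series_one F w = F w.
Proof.
case: w => [|a w] /=; first by rewrite mul1r addr0.
by rewrite mul1r conv_eq0 ?addr0 // => u v _; rewrite mul0r.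
Qed.

Lemma convs1 F w : conv F series_one w = F w.
Proof.
rewrite -{1}[w]cats0 conv_split ?mulr1 // => u v; rewrite cats0 => ->.
by case: v => [|a v]; rewrite ?cats0 ?eqxx // mulr0.
Qed.

Definition series_mul F G : series S := conv F G.

Fact series_mulA : associative series_mul.
Proof. by move=> F G H; apply/funext => w; exact: convA. Qed.
Fact series_mul1s : left_id series_one series_mul.
Proof. by move=> F; apply/funext => w; exact: conv1s. Qed.
Fact series_muls1 : right_id series_one series_mul.
Proof. by move=> F; apply/funext => w; exact: convs1. Qed.
Fact series_mulDl : left_distributive series_mul +%R.
Proof. by move=> F G H; apply/funext => w; exact: convDl. Qed.
Fact series_mulDr : right_distributive series_mul +%R.
Proof. by move=> F G H; apply/funext => w; exact: convDr. Qed.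

HB.instance Definition _ := GRing.Zmodule_isPzRing.Build (series S)
  series_mulA series_mul1s series_muls1 series_mulDl series_mulDr.

HB.instance Definition _ := Zmodule_isLieRing.Build (series S)
  (@rcommDl _) (@rcommDr _) (@rcommxx _) (@rcomm_jacobi _).

Lemma series1E w : (1 : series S) w = (w == [::])%:R. Proof. by []. Qed.
Lemma seriesDE F G w : (F + G) w = F w + G w. Proof. by []. Qed.
Lemma seriesBE F G w : (F - G) w = F w - G w. Proof. by []. Qed.
Lemma seriesME F G w : (F * G) w = conv F G w. Proof. by []. Qed.
Lemma series_lbr F G : lbr F G = rcomm F G. Proof. by []. Qed.
Lemma series_lbrE F G w : (lbr F G) w = conv F G w - conv G F w.
Proof. by []. Qed.

Definition coef w F : int := F w.

Fact coef_nmod_morphism w : nmod_morphism (coef w). Proof. by []. Qed.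

HB.instance Definition _ w :=
  GRing.isNmodMorphism.Build (series S) int (coef w) (coef_nmod_morphism w).

Definition letter (s : S) : series S := fun w => (w == [:: s])%:R.

End Series.

(** * Lyndon words and Hall trees *)

Section LexicographicOrder.
Variables (d : Order.disp_t) (S : orderType d).
Implicit Types u v w s : seq S.
Local Open Scope order_scope.

(** If [u] is not a prefix of [v], the first letter where they differ decides the comparison,
    whatever is appended to either word. *)
Lemma lexi_cases u v : u < v ->
  (exists2 s, s != [::] & v = u ++ s) \/ (forall s s', u ++ s < v ++ s').
Proof.
elim: u v => [|a u IH] [|b v] //= uv; first by left; exists (b :: v).
have [ab|ab] := eqVneq a b; last first.
  by right=> s s'; move: uv; rewrite !neqhead_ltxiE.
subst b; move: uv; rewrite eqhead_ltxiE => /IH [[s s0 ->]|H].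
  by left; exists s.
by right=> s s'; rewrite eqhead_ltxiE.
Qed.

Lemma lexi_cat2l u v w : (u ++ v < u ++ w) = (v < w).
Proof. by elim: u => [|a u IH] //=; rewrite eqhead_ltxiE. Qed.

Lemma lexi_prefix u v : u <= u ++ v.
Proof. by elim: u => [|a u IH] /=; rewrite ?lexi0s // eqhead_lexiE. Qed.

Lemma lexi_prefix_lt u v : v != [::] -> u < u ++ v.
Proof.
move=> v0; rewrite lt_neqAle lexi_prefix andbT -{1}[u]cats0.
by rewrite eqseq_cat // eqxx eq_sym.
Qed.

Lemma lexi_cat_size u u' v v' :
  size u = size u' -> u < u' -> u ++ v < u' ++ v'.
Proof.
move=> E /lexi_cases [[s s0 us]|]; last exact.
move/eqP: E; rewrite us size_cat -[X in X == _]addn0 eqn_add2l eq_sym.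
by rewrite size_eq0 (negbTE s0).
Qed.

(** Compare the two cuts of the common word: [r] is the segment between them, nonempty in the second
    case so that equal cuts fall in the first only. *)
Lemma cat_eq_cases u v s s' : u ++ v = s ++ s' ->
  (exists2 r, s = u ++ r & v = r ++ s') \/
  (exists r, [/\ r != [::], u = s ++ r & s' = r ++ v]).
Proof.
elim: u s => [|a u IH] [|b s] /=.
- by move=> ->; left; exists [::].
- by move=> ->; left; exists (b :: s).
- by move=> <-; right; exists (a :: u).
move=> [-> /IH [[r -> ->]|[r [r0 -> ->]]]]; first by left; exists r.
by right; exists r.
Qed.

End LexicographicOrder.

Section HallTrees.
Variables (d : Order.disp_t) (S : orderType d).
Implicit Types (t a b : lie_term S) (w : seq S).

Fixpoint foliage t : seq S :=
  match t with
  | LVar s => [:: s]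
  | LBr a b => foliage a ++ foliage b
  | _ => [::]
  end.

(* The Hall trees of the Lyndon words: the Lyndon words are their foliages, and
   the right branch carries the smallest proper suffix of the foliage. *)
Fixpoint hall t : bool :=
  match t with
  | LVar _ => true
  | LBr a b => [&& hall a, hall b, (foliage a < foliage b)%O
                 & if a is LBr _ a2 then (foliage b <= foliage a2)%O else true]
  | _ => false
  end.

Lemma hall_foliage_neq0 t : hall t -> foliage t != [::].
Proof.
elim: t => [s||t _|t _ t' _|t IH t' _] //= /and4P[/IH + _ _ _].
by case: (foliage t).
Qed.

(** The foliage lies below that of the right branch, which is the least proper suffix; hence it is a
    Lyndon word. The induction needs both facts at once. *)
Lemma hall_lyndon t : hall t ->
  forall s s', foliage t = s ++ s' -> s != [::] -> s' != [::] ->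
  (foliage t < s')%O /\ (if t is LBr _ b then foliage b <= s' else true)%O.
Proof.
elim: t => [x||t _|t _ t' _|a IHa b IHb] //=.
  by move=> _ [|y [|z s]] // [|y' s'].
move=> /and4P[ha hb ab hab]; have a0 := hall_foliage_neq0 ha.
have b0 := hall_foliage_neq0 hb.
(* Either the first difference between the two foliages decides, or the foliage of [b] is that of
   [a] followed by [s], and the Lyndon property of [b] puts it below [s]. *)
have L : (foliage a ++ foliage b < foliage b)%O.
  have [[s s0 E]|H] := lexi_cases ab; last by have := H (foliage b) [::]; rewrite cats0.
  by rewrite {2}E lexi_cat2l; case: (IHb hb _ _ E).
have M s s' : foliage a ++ foliage b = s ++ s' -> s != [::] -> s' != [::] ->
    (foliage b <= s')%O.
  move=> /cat_eq_cases [[r -> Eb]|[r [r0 Ea ->]]] s0 s'0.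
    have [r0|r0] := eqVneq r [::]; first by rewrite Eb r0.
    by apply: ltW; case: (IHb hb _ _ Eb).
  (* The cut falls inside the foliage of [a], which is then no leaf: the Hall condition bounds the
     foliage of [b] by that of [a2], and induction bounds the latter by [r]. *)
  case: a ha IHa Ea hab {ab L a0} => [x||t|t t'|a1 a2] // ha IHa Ea hab.
    by case: s s0 Ea => // y [|z s] _; case: r r0 s'0.
  apply: le_trans hab _; apply: le_trans (lexi_prefix _ _).
  by case: (IHa ha _ _ Ea).
move=> s s' E s0 s'0; have b's := M _ _ E s0 s'0; split=> //.
exact: lt_le_trans b's.
Qed.

(** The right branch carries the least proper suffix, so the foliage determines where it is cut, and
    both branches follow by induction. *)
Lemma hall_foliage_inj t t' : hall t -> hall t' -> foliage t = foliage t' -> t = t'.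
Proof.
elim: t t' => [x||t _|t _ t' _|a IHa b IHb] // [y||t'|t' t''|a' b'] //.
- by move=> _ _ [->].
- move=> _ /= /and4P[/hall_foliage_neq0 + /hall_foliage_neq0 + _ _].
  by case: (foliage a') => // ? [|? ?] //=; case: (foliage b').
- move=> /= /and4P[/hall_foliage_neq0 + /hall_foliage_neq0 + _ _] _.
  by case: (foliage a) => // ? [|? ?] //=; case: (foliage b).
move=> h h' /[dup] E /= E'; have [/= Lh Lh'] := (hall_lyndon h, hall_lyndon h').
move: (h) (h') => /= /and4P[ha hb _ _] /and4P[ha' hb' _ _].
have Eb : foliage b = foliage b'.
  apply/le_anti/andP; split.
    by case: (Lh (foliage a') (foliage b')) => //; exact: hall_foliage_neq0.
  by case: (Lh' (foliage a) (foliage b)) => //; exact: hall_foliage_neq0.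
have := congr1 size E'; rewrite !size_cat Eb => /addIn sa.
move/eqP: E'; rewrite eqseq_cat // => /andP[/eqP /IHa -> // /eqP /IHb -> //].
Qed.

Local Notation eval := (lie_eval (@letter S)).

Lemma hall_eval_size t w : hall t -> size w != size (foliage t) -> eval t w = 0.
Proof.
elim: t w => [x||t _|t _ t' _|a IHa b IHb] w //=.
  by move=> _ ws; rewrite /letter (negbTE (contraNneq _ ws)) // => ->.
move=> /and4P[ha hb _ _]; rewrite size_cat => ws.
rewrite series_lbrE !conv_eq0 ?subrr // => u v E.
  have [ub|/IHb-> //] := eqVneq (size u) (size (foliage b)); last exact: mul0r.
  rewrite (IHa v) ?mulr0 //; move: ws.
  by rewrite E size_cat ub addnC eqn_add2r.
have [ua|/IHa-> //] := eqVneq (size u) (size (foliage a)); last exact: mul0r.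
rewrite (IHb v) ?mulr0 //; move: ws.
by rewrite E size_cat ua eqn_add2l.
Qed.

(** Of the two products in the commutator, only [eval a * eval b] reaches down to the foliage. Its
    smallest word is the concatenation of those of the factors, because all words of a factor have
    the same length. *)
Lemma hall_eval_triangular t : hall t ->
  eval t (foliage t) = 1 /\ forall w, (w < foliage t)%O -> eval t w = 0.
Proof.
elim: t => [x||t _|t _ t' _|a IHa b IHb] //=.
  by move=> _; rewrite /letter eqxx; split=> // w /lt_eqF ->.
move=> /[dup] h /and4P[ha hb ab _].
have [[a1 a0] [b1 b0]] := (IHa ha, IHb hb).
have uvv : (foliage a ++ foliage b < foliage b)%O.
  by case: (hall_lyndon (t := LBr a b) h erefl) => //; exact: hall_foliage_neq0.
have low u c (n : int) : hall c -> (forall w, (w < foliage c)%O -> eval c w = 0) ->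
  eval c u * n != 0 -> (foliage c <= u)%O /\ size u = size (foliage c).
  move=> hc c0 nz; split.
    by rewrite leNgt; apply: contra nz => /c0 ->; rewrite mul0r.
  by apply/eqP; apply: contraNT nz => /(hall_eval_size hc) ->; rewrite mul0r.
(* A word of [eval b * eval a] begins with a word at least the foliage of [b], which already exceeds
   the Lyndon word of the tree. *)
have ba0 w : (w <= foliage a ++ foliage b)%O -> conv (eval b) (eval a) w = 0.
  move=> wab; apply: conv_eq0 => u v E; apply/eqP/negPn/negP.
  move=> /(low _ _ _ hb b0) [bu su].
  have := le_lt_trans wab uvv; rewrite E ltNge (le_trans bu) //.
  exact: lexi_prefix.
split=> [|w wab]; rewrite series_lbrE ba0 ?subr0 //; last exact: ltW.
  rewrite conv_split ?a1 ?b1 // => u v E su.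
  by rewrite (hall_eval_size ha su) mul0r.
apply: conv_eq0 => u v E; apply/eqP/negPn/negP => /[dup] nz.
move=> /(low _ _ _ ha a0) [au su].
(* A left factor above the foliage of [a], of the same length, would make [w] too large; if it
   equals that foliage, the rest is below the foliage of [b], where [eval b] vanishes. *)
move: au; rewrite le_eqVlt => /orP[/eqP ua|au]; last first.
  by move: wab; rewrite E ltNge ltW // lexi_cat_size.
move: wab nz; rewrite E -ua lexi_cat2l => /b0 ->.
by rewrite mulr0 eqxx.
Qed.

End HallTrees.

(** * Integral spans and identities in Lie rings *)

Lemma big_uniq_widen (I : eqType) (s s' : seq I) (V : nmodType) (F : I -> V) :
  uniq s -> uniq s' -> {subset s <= s'} -> (forall i, i \notin s -> F i = 0) ->
  \sum_(i <- s) F i = \sum_(i <- s') F i.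
Proof.
move=> us us' ss' F0; rewrite [RHS](bigID (mem s)) /= [X in _ + X]big1 // addr0.
rewrite -[RHS]big_filter; apply/perm_big/uniq_perm; rewrite ?filter_uniq // => i.
by rewrite mem_filter; case: (boolP (i \in s)) => // /ss'.
Qed.

Section IntegralSpan.
Variable V : zmodType.
Implicit Types (A B : set V) (u v : V).

Inductive zspan A : V -> Prop :=
| ZSpan0 : zspan A 0
| ZSpanIn u of A u : zspan A u
| ZSpanD u v of zspan A u & zspan A v : zspan A (u + v)
| ZSpanN u of zspan A u : zspan A (- u).

Lemma zspan_morph A B (f : V -> V) : {morph f : u v / u + v} ->
  (forall u, A u -> zspan B (f u)) -> forall u, zspan A u -> zspan B (f u).
Proof.
move=> fD AB; have f0 : f 0 = 0 by apply: (addrI (f 0)); rewrite -fD !addr0.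
move=> u; elim=> {u} [|u /AB //|u v _ Hu _ Hv|u _ Hu].
- by rewrite f0; exact: ZSpan0.
- by rewrite fD; exact: ZSpanD.
suff -> : f (- u) = - f u by exact: ZSpanN.
by apply/eqP; rewrite -addr_eq0 -fD addNr f0.
Qed.

Lemma zspan_sub A B u : (A `<=` B)%classic -> zspan A u -> zspan B u.
Proof.
by move=> AB; apply: (@zspan_morph A B id) => // v /AB; exact: ZSpanIn.
Qed.

(** The indices are made distinct so that each coefficient can be isolated later. *)
Lemma zspan_sum (I : eqType) (P : pred I) (f : I -> V) u :
  zspan [set v | exists2 i, P i & v = f i]%classic u ->
  exists (s : seq I) (c : I -> int),
    [/\ uniq s, all P s & u = \sum_(i <- s) f i *~ c i].
Proof.
elim=> {u} [|u [i Pi ->]|u v _ [s [c [us Ps ->]]] _ [s' [c' [us' Ps' ->]]]|].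
- by exists [::], (fun=> 0); split=> //; rewrite big_nil.
- by exists [:: i], (fun=> 1); split=> //=; rewrite ?Pi // big_seq1 mulr1z.
- exists (undup (s ++ s')).
  (* A coefficient function is arbitrary off its own list, hence the cut to 0 before adding. *)
  exists (fun i => (if i \in s then c i else 0) + (if i \in s' then c' i else 0)).
  split; first exact: undup_uniq.
    by apply/allP => i; rewrite mem_undup mem_cat => /orP[/(allP Ps)|/(allP Ps')].
  under [RHS]eq_bigr do rewrite mulrzDr.
  rewrite big_split /=; congr (_ + _).
    rewrite -[RHS](@big_uniq_widen _ s) ?undup_uniq // => [|i si|i /negbTE->] //.
    + by apply: eq_big_seq => i ->.
    + by rewrite mem_undup mem_cat si.
  rewrite -[RHS](@big_uniq_widen _ s') ?undup_uniq // => [|i si|i /negbTE->] //.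
  + by apply: eq_big_seq => i ->.
  + by rewrite mem_undup mem_cat si orbT.
move=> u _ [s [c [us Ps ->]]]; exists s, (fun i => - c i); split=> //.
by rewrite -sumrN; apply: eq_bigr => i _; rewrite mulrNz.
Qed.

End IntegralSpan.

Section LieIdentities.
Variable L : lieRingType.
Implicit Types u v w : L.

Lemma lbrC u v : lbr u v = - lbr v u.
Proof.
have := lbrxx (u + v); rewrite lbrDl !lbrDr !lbrxx add0r addr0.
by move/eqP; rewrite addr_eq0 => /eqP.
Qed.

Lemma lbr0l u : lbr 0 u = 0.
Proof. by apply: (addrI (lbr 0 u)); rewrite -lbrDl !addr0. Qed.

Lemma lbrNl u v : lbr (- u) v = - lbr u v.
Proof. by apply/eqP; rewrite -addr_eq0 -lbrDl addNr lbr0l. Qed.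

(** Bracketing with [w] on the right is a derivation: the form of the Jacobi identity that expands a
    bracket whose left entry is a bracket. *)
Lemma lbr_jacobil u v w :
  lbr (lbr u v) w = lbr (lbr u w) v + lbr u (lbr v w).
Proof.
have := lbr_jacobi u v w.
rewrite (lbrC w (lbr u v)) (lbrC v (lbr w u)) (lbrC w u) lbrNl.
by rewrite opprK => /subr0_eq <-; rewrite addrC.
Qed.

End LieIdentities.

Section LieLift.
Variables (S : Type) (L : lieRingType) (f : S -> L).

Fact lie_lift_nmod_morphism : nmod_morphism (lie_lift f).
Proof.
have fD := (lie_lift_morphism f).1; split=> //.
by apply: (addrI (lie_lift f 0)); rewrite -fD !addr0.
Qed.

HB.instance Definition _ :=
  GRing.isNmodMorphism.Build (free_lie S) L (lie_lift f) lie_lift_nmod_morphism.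

End LieLift.

Lemma seq_argmin (d : Order.disp_t) (T : orderType d) (I : eqType) (f : I -> T)
    (s : seq I) : s != [::] ->
  exists2 i, i \in s & forall j, j \in s -> (f i <= f j)%O.
Proof.
elim: s => // i [_ _|j s IH _].
  by exists i; rewrite ?mem_head // => j /[1!inE] /eqP->.
have [//|k ks Hk] := IH; have [ik|ki] := leP (f i) (f k).
  exists i; rewrite ?mem_head // => l /[1!inE] /predU1P[->//|/Hk].
  exact: le_trans.
exists k; first by rewrite inE ks orbT.
by move=> l /[1!inE] /predU1P[->|/Hk //]; exact: ltW.
Qed.

(** * The Hall trees as a basis, and the embedding of the free Lie ring in the series *)

Section FreeLieEmbedding.
Variables (d : Order.disp_t) (S : finOrderType d).
Implicit Types (t a b : lie_term S) (w : seq S).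

Definition lie_tree t : free_lie S := \pi_(free_lie S) t.

Lemma lie_tree_br a b : lie_tree (LBr a b) = lbr (lie_tree a) (lie_tree b).
Proof. by rewrite [RHS]fl_br_pi. Qed.

(** The lexicographic order on all words is in general not well founded. With lengths bounded by [n]
    over a finite alphabet only finitely many words lie below [w], and their number serves as a
    termination measure. *)
Definition rank n w := #|[pred s : n.-bseq S | (s < w :> seq S)%O]|.

Lemma rank_lt n w w' : (size w <= n)%N -> (w < w')%O -> (rank n w < rank n w')%N.
Proof.
move=> wn ww'; apply/proper_card/properP; split.
  by apply/fintype.subsetP => s; rewrite !inE => /lt_trans ->.
by exists (Bseq wn); rewrite inE //= ltxx.
Qed.

Definition hall_below n w : set (free_lie S) :=
  [set u | exists2 t, [&& hall t, size (foliage t) == n & (foliage t < w)%O]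
                    & u = lie_tree t]%classic.

(* Induction on the total size, then on the larger of the two foliages: the
   Jacobi identity replaces the bracket of a = [a1, a2] and b by brackets of
   Hall trees with foliages smaller than that of b. *)
Lemma hall_bracket a b : hall a -> hall b ->
  zspan (hall_below (size (foliage a) + size (foliage b))%N
           (Order.max (foliage a) (foliage b)))
        (lbr (lie_tree a) (lie_tree b)).
Proof.
have [n] := ubnP (size (foliage a) + size (foliage b))%N.
elim: n a b => // n IHn a b; rewrite ltnS => sn.
have [m] := ubnP (rank n (Order.max (foliage a) (foliage b))).
elim: m a b sn => // m IHm a b sn; rewrite ltnS => rm ha hb.
wlog ab : a b sn rm ha hb / (foliage a < foliage b)%O => [W|].
  case: (ltgtP (foliage a) (foliage b)) => [ab|ba|/(hall_foliage_inj ha hb) ->].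
  - by have := W _ _ sn rm ha hb ab; rewrite (max_r (ltW ab)).
  - rewrite lbrC; apply: ZSpanN; move: rm; rewrite (max_l (ltW ba)) => rm.
    by have := W b a; rewrite addnC (max_r (ltW ba)); apply.
  - by rewrite lbrxx; exact: ZSpan0.
move: rm; rewrite (max_r (ltW ab)) => rm.
have [h|nh] := boolP (hall (LBr a b)).
  rewrite -lie_tree_br; apply: ZSpanIn; exists (LBr a b) => //.
  rewrite h /= size_cat eqxx /=.
  by case: (hall_lyndon h erefl) => //; exact: hall_foliage_neq0.
case: a ha ab sn nh rm => [x||t|t t'|a1 a2] // ha ab sn nh rm.
  by move: nh; rewrite /= hb ab.
(* The other conditions of [hall] hold, so the one comparing [b] with the right branch of [a] must
   fail. *)
have {nh} a2b : (foliage a2 < foliage b)%O.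
  by rewrite ltNge; apply: contra nh => ba2; apply/and4P.
move: (ha) => /= /and4P[ha1 ha2 _ _].
have a10 := hall_foliage_neq0 ha1; have a20 := hall_foliage_neq0 ha2.
have a1b : (foliage a1 < foliage b)%O.
  by apply: lt_trans ab; exact: lexi_prefix_lt.
(* With the total size unchanged and both foliages below that of [b], the rank of the larger one
   drops and the inner induction applies. *)
have step c e : hall c -> hall e -> (foliage c < foliage b)%O ->
    (foliage e < foliage b)%O ->
    (size (foliage c) + size (foliage e) =
      size (foliage (LBr a1 a2)) + size (foliage b))%N ->
  zspan (hall_below (size (foliage (LBr a1 a2)) + size (foliage b))%N (foliage b))
    (lbr (lie_tree c) (lie_tree e)).
  move=> hc he cb eb ce; have mb : (Order.max (foliage c) (foliage e) < foliage b)%O.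
    by rewrite gt_max cb.
  apply: zspan_sub (IHm c e _ _ hc he); last 2 first.
  - by rewrite ce.
  - apply: leq_trans rm; apply: rank_lt => //.
    have /andP[cn en] : (size (foliage c) <= n)%N && (size (foliage e) <= n)%N.
      by move: sn; rewrite -ce => cen; rewrite !(leq_trans _ cen) ?leq_addr ?leq_addl.
    by rewrite maxEle; case: ifP.
  move=> _ [t /and3P[ht st tc] ->]; exists t => //.
  by rewrite ht -ce st (lt_trans tc).
(* The brackets of [a1] with [b] and of [a2] with [b] have smaller total size: the outer induction
   expands them in Hall trees below the foliage of [b], and [step] treats the brackets of these with
   the remaining branch. *)
rewrite lie_tree_br lbr_jacobil; apply: ZSpanD.
  have lin : {morph (fun u : free_lie S => lbr u (lie_tree a2)) : u v / u + v}.
    by move=> u v; rewrite lbrDl.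
  apply: (zspan_morph lin) (IHn a1 b _ ha1 hb) => [_ [t /and3P[ht /eqP st tb] ->]|].
    apply: step => //; first by rewrite (max_r (ltW a1b)) in tb.
    by rewrite st /= size_cat addnAC.
  apply: leq_trans sn; rewrite /= size_cat ltn_add2r -[ltnLHS]addn0 ltn_add2l.
  by rewrite lt0n size_eq0.
have lin : {morph (fun u : free_lie S => lbr (lie_tree a1) u) : u v / u + v}.
  by move=> u v; rewrite lbrDr.
apply: (zspan_morph lin) (IHn a2 b _ ha2 hb) => [_ [t /and3P[ht /eqP st tb] ->]|].
  apply: step => //; first by rewrite (max_r (ltW a2b)) in tb.
  by rewrite st /= size_cat addnA.
apply: leq_trans sn; rewrite /= size_cat ltn_add2r -[ltnLHS]add0n ltn_add2r.
by rewrite lt0n size_eq0.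
Qed.

Lemma hall_span (u : free_lie S) :
  zspan [set v | exists2 t, hall t & v = lie_tree t]%classic u.
Proof.
elim/quotW: u; elim=> [s||t IH|t IHt t' IHt'|a IHa b IHb].
- by apply: ZSpanIn; exists (LVar s).
- exact: ZSpan0.
- by rewrite -fl_opp_pi; exact: ZSpanN.
- by rewrite -fl_add_pi; exact: ZSpanD.
rewrite -fl_br_pi.
have linl u : {morph (fun v : free_lie S => lbr u v) : v w / v + w}.
  by move=> v w; rewrite lbrDr.
have linr u : {morph (fun v : free_lie S => lbr v u) : v w / v + w}.
  by move=> v w; rewrite lbrDl.
apply: (zspan_morph (linr _) _ IHa) => _ [t ht ->].
apply: (zspan_morph (linl _) _ IHb) => _ [t' ht' ->].
apply: zspan_sub (hall_bracket ht ht') => _ [c /and3P[hc _ _] ->].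
by exists c.
Qed.

(** In a combination of Hall trees sent to 0, take the tree of smallest foliage among those with
    nonzero coefficient. By triangularity no other tree contributes to that word, so its coefficient
    is 0, a contradiction. *)
Theorem free_lie_series_inj : injective (lie_lift (@letter S)).
Proof.
apply: raddf_inj => u u0; have [s [c [us hs Eu]]] := zspan_sum (hall_span u).
rewrite Eu big_seq big1 // => t ts; apply/eqP; apply: contraT => nz.
pose s' := [seq t <- s | c t != 0].
have ts' : t \in s' by rewrite mem_filter ts andbT; apply: contraNneq nz => ->.
have [] := @seq_argmin _ (seq S) _ (fun t => foliage t) s'.
  by apply/eqP => E; rewrite E in ts'.
move=> m; rewrite mem_filter => /andP[cm ms] min_m; case/negP: cm; apply/eqP.
have hm := allP hs _ ms.
have := congr1 (coef (foliage m)) u0.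
rewrite Eu raddf0 !raddf_sum /= (bigD1_seq m) //= big_seq_cond big1 => [|j].
  rewrite addr0 !raddfMz /= lie_lift_pi /coef (hall_eval_triangular hm).1.
  by rewrite -mulrzr mul1r intz.
move=> /andP[js jm]; rewrite !raddfMz /= lie_lift_pi.
have hj := allP hs _ js; have [cj|cj] := eqVneq (c j) 0; first by rewrite cj mulr0z.
have : (foliage m <= foliage j)%O by apply: min_m; rewrite mem_filter cj.
rewrite le_eqVlt => /orP[/eqP /(hall_foliage_inj hm hj) mj|mj].
  by rewrite mj eqxx in jm.
by rewrite /coef (hall_eval_triangular hj).2 ?mul0rz.
Qed.

End FreeLieEmbedding.

(** * The Magnus embedding *)

Section UnitGroup.
Variable R : pzRingType.
Implicit Types u : R * R.

(** A unit is stored with its two-sided inverse, so that inversion in the group is the exchange of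
    components. *)
Definition is_unit_pair u := (u.1 * u.2 == 1) && (u.2 * u.1 == 1).
Definition unit_pair := {u | is_unit_pair u}.
HB.instance Definition _ := Choice.on unit_pair.
Implicit Types x y z : unit_pair.

Lemma unit_pairP x :
  (val x).1 * (val x).2 = 1 /\ (val x).2 * (val x).1 = 1.
Proof. by have /andP[/eqP ? /eqP ?] := valP x. Qed.

Fact unit_mul_subproof x y :
  is_unit_pair ((val x).1 * (val y).1, (val y).2 * (val x).2).
Proof.
have [[x1 x2] [y1 y2]] := (unit_pairP x, unit_pairP y).
by rewrite /is_unit_pair /= mulrA -(mulrA _ (val y).1) y1 mulr1 x1 eqxx mulrA
  -(mulrA (val y).2) x2 mulr1 y2 eqxx.
Qed.

Fact unit_inv_subproof x : is_unit_pair ((val x).2, (val x).1).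
Proof. by have [x1 x2] := unit_pairP x; rewrite /is_unit_pair /= x1 x2 eqxx. Qed.

Fact unit_one_subproof : is_unit_pair (1, 1).
Proof. by rewrite /is_unit_pair /= mulr1 eqxx. Qed.

Definition unit_mul x y : unit_pair := Sub _ (unit_mul_subproof x y).
Definition unit_inv x : unit_pair := Sub _ (unit_inv_subproof x).
Definition unit_one : unit_pair := Sub _ unit_one_subproof.

Lemma unit_pair_eq x y : (val x).1 = (val y).1 -> (val x).2 = (val y).2 -> x = y.
Proof.
move=> E1 E2; apply: val_inj.
by rewrite [val x]surjective_pairing E1 E2 -surjective_pairing.
Qed.

Fact unit_mulA : associative unit_mul.
Proof. by move=> x y z; apply: unit_pair_eq; rewrite /= mulrA. Qed.
Fact unit_mul1x : left_id unit_one unit_mul.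
Proof. by move=> x; apply: unit_pair_eq; rewrite /= ?mul1r ?mulr1. Qed.
Fact unit_mulx1 : right_id unit_one unit_mul.
Proof. by move=> x; apply: unit_pair_eq; rewrite /= ?mul1r ?mulr1. Qed.
Fact unit_mulVx : left_inverse unit_one unit_inv unit_mul.
Proof.
by move=> x; have [x1 x2] := unit_pairP x; apply: unit_pair_eq; rewrite /= ?x1 ?x2.
Qed.
Fact unit_mulxV : right_inverse unit_one unit_inv unit_mul.
Proof.
by move=> x; have [x1 x2] := unit_pairP x; apply: unit_pair_eq; rewrite /= ?x1 ?x2.
Qed.

HB.instance Definition _ := isGroup.Build unit_pair
  unit_mulA unit_mul1x unit_mulx1 unit_mulVx unit_mulxV.

End UnitGroup.

Lemma free_group_ind (S : choiceType) (P : free_group S -> Prop) :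
  P 1%g -> (forall s g, P g -> P (fg_gen s * g)%g) ->
  (forall s g, P g -> P ((fg_gen s)^-1 * g)%g) -> forall g, P g.
Proof.
move=> P1 Pg PV; elim/quotW; elim=> [|[s b] w IH]; first exact: P1.
rewrite -cat1s -fg_mul_pi; case: b; first exact: Pg.
by have := PV s _ IH; rewrite [((fg_gen s)^-1)%g]fg_inv_pi.
Qed.

Section Magnus.
Variable S : choiceType.
Implicit Types (s : S) (g h : free_group S).

(* The inverse of 1 + s is 1 - s + s ^ 2 - ... *)
Definition letter_geom s : series S :=
  fun w => if all (pred1 s) w then (-1) ^+ size w else 0.

Fact magnus_gen_subproof s : is_unit_pair (1 + letter s, letter_geom s).
Proof.
(* Deleting a first letter [a] from 1 + s leaves a constant series, 1 if [a] is [s] and 0 otherwise,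
   so the recursion of [conv] collapses. *)
have E a : conv (fun v => (1 + letter s) (a :: v)) =
    conv (fun v => (a == s)%:R * (1 : series S) v).
  congr (@conv S); apply/funext => v; rewrite seriesDE !series1E /letter /= add0r.
  by rewrite eqseq_cons -natrM mulnb.
apply/andP; split; apply/eqP/funext => w /=; rewrite seriesME.
  case: w => [|a w] /=; first by rewrite addr0.
  rewrite E convZl -seriesME mul1r series1E /= /letter_geom /=.
  rewrite seriesDE series1E /letter /= addr0 mul1r exprS mulN1r.
  case: (a == s) => /=; rewrite ?mul0r ?add0r // mul1r.
  by case: ifP; rewrite ?subrr ?addNr ?addr0.
elim: w => [|a w IH] /=; first by rewrite addr0.
have -> : (fun v => letter_geom s (a :: v)) = (fun v => - (a == s)%:R * letter_geom s v).
  apply/funext => v; rewrite /letter_geom /= exprS.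
  by case: (a == s); rewrite /= ?oppr0 ?mul0r //; case: ifP; rewrite ?mulr0.
rewrite convZl IH series1E seriesDE series1E /letter /= eqseq_cons.
rewrite /letter_geom /= mul1r add0r.
by case: (a == s); case: w {IH}.
Qed.

Definition magnus_gen s : unit_pair (series S) := Sub _ (magnus_gen_subproof s).

Definition magnus g : series S := (val (fg_lift magnus_gen g)).1.

Lemma magnus_genE s : magnus (fg_gen s) = 1 + letter s.
Proof. by rewrite /magnus fg_lift_gen. Qed.

Lemma magnusM g h : magnus (g * h)%g = magnus g * magnus h.
Proof. by rewrite /magnus fg_liftM. Qed.

Lemma magnus1 : magnus 1%g = 1.
Proof.
by rewrite /magnus (_ : fg_lift _ _ = 1%g) // [LHS]fg_lift_pi.
Qed.

Lemma magnusVK g : magnus g^-1%g * magnus g = 1.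
Proof. by rewrite -magnusM mulVg magnus1. Qed.

Lemma magnusKV g : magnus g * magnus g^-1%g = 1.
Proof. by rewrite -magnusM mulgV magnus1. Qed.

Lemma magnus_const g : magnus g [::] = 1.
Proof.
have constM (F G : series S) : (F * G) [::] = F [::] * G [::] by rewrite [LHS]addr0.
have constg s : magnus (fg_gen s) [::] = 1 by rewrite magnus_genE.
elim/free_group_ind: g => [|s g IH|s g IH];
  rewrite ?magnus1 ?magnusM ?constM ?IH ?mulr1 //.
have := congr1 (coef [::]) (magnusVK (fg_gen s)).
by rewrite /coef constM constg mulr1.
Qed.

(** Since 1 is central, gh - hg is also the commutator of g - 1 and h - 1; it remains to multiply by
    the inverse of hg. This form makes the bidegrees add up. *)
Lemma magnus_comm g h :
  magnus (comm g h) - 1 =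
  lbr (magnus g - 1) (magnus h - 1) * magnus (g^-1 * h^-1)%g.
Proof.
have -> : comm g h = (g * h * (g^-1 * h^-1))%g by rewrite /comm !mulgA.
have E1 : magnus (h * g * (g^-1 * h^-1))%g = 1.
  by rewrite !mulgA mulgK mulgV magnus1.
rewrite -[X in _ - X = _]E1 (magnusM (g * h)%g) (magnusM (h * g)%g) -mulrBl.
rewrite !magnusM; congr (_ * _).
have commN1 (F : series S) : rcomm F (-1) = 0 /\ rcomm (-1) F = 0.
  by rewrite /rcomm mulrN mulNr mulr1 mul1r !subrr.
by rewrite series_lbr rcommDl !rcommDr !(commN1 _).1 (commN1 _).2 !addr0.
Qed.

End Magnus.

(** * Bidegrees of words and the ideals of series that they define *)

Section Bidegree.
Variables A B : choiceType.
Local Notation S := (A + B)%type.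
Implicit Types (F G : series S) (w u v : seq S) (m n : nat).

Definition bidegx w := count (fun s : S => if s is inl _ then true else false) w.
Definition bidegy w := count (fun s : S => if s is inl _ then false else true) w.
Definition bideg w := (bidegx w, bidegy w).

Lemma bidegx_cat u v : bidegx (u ++ v) = (bidegx u + bidegx v)%N.
Proof. exact: count_cat. Qed.
Lemma bidegy_cat u v : bidegy (u ++ v) = (bidegy u + bidegy v)%N.
Proof. exact: count_cat. Qed.

Lemma bideg_eq0 w : (bideg w == (0, 0)%N) = (w == [::]).
Proof. by case: w => [|[a|b] w]; rewrite /bideg /bidegx /bidegy xpair_eqE ?andbF. Qed.

Definition bideal m n F :=
  forall w, F w != 0 -> (m <= bidegx w)%N /\ (n <= bidegy w)%N.

Lemma bideal00 F : bideal 0 0 F. Proof. by []. Qed.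

Lemma bideal0 m n : bideal m n 0. Proof. by move=> w /eqP. Qed.

Lemma bidealD m n F G : bideal m n F -> bideal m n G -> bideal m n (F + G).
Proof.
move=> HF HG w; rewrite seriesDE.
by have [->|/HF//] := eqVneq (F w) 0; rewrite add0r => /HG.
Qed.

Lemma bidealN m n F : bideal m n F -> bideal m n (- F).
Proof. by move=> HF w; rewrite oppr_eq0 => /HF. Qed.

Lemma bidealM m n m' n' F G :
  bideal m n F -> bideal m' n' G -> bideal (m + m') (n + n') (F * G).
Proof.
move=> HF HG w nz; apply: contrapT => nd; case/negP: nz; apply/eqP.
apply: conv_eq0 => u v E; apply/eqP; rewrite mulf_eq0 -[_ || _]negbK negb_or.
apply/negP => /andP[/HF[Fx Fy] /HG[Gx Gy]]; apply: nd.
by rewrite E bidegx_cat bidegy_cat !leq_add.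
Qed.

Lemma bidealMr m n F G : bideal m n F -> bideal m n (F * G).
Proof.
by move=> HF; rewrite -[m]addn0 -[n]addn0; apply: bidealM => //; exact: bideal00.
Qed.

Lemma bidealMl m n F G : bideal m n F -> bideal m n (G * F).
Proof. by move=> HF; apply: (bidealM (@bideal00 G) HF). Qed.

Lemma bideal_lbr m n m' n' F G :
  bideal m n F -> bideal m' n' G -> bideal (m + m') (n + n') (lbr F G).
Proof.
move=> HF HG; rewrite series_lbr /rcomm; apply: bidealD; first exact: bidealM.
by apply: bidealN; rewrite addnC [(n + _)%N]addnC; exact: bidealM.
Qed.

Definition bihom (d : N2p) F : series S := fun w => if bideg w == val d then F w else 0.

(** In a nonzero term the factors have bidegrees at least [d] and [e]; if these add up to d + e,
    both are equalities, so truncating the factors changes no term. *)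
Lemma bihom_conv d e F G w :
  bideal (dx d) (dy d) F -> bideal (dx e) (dy e) G ->
  conv (bihom d F) (bihom e G) w =
  if bideg w == val (dadd d e) then conv F G w else 0.
Proof.
move=> HF HG; case: ifPn => wde; last first.
  apply: conv_eq0 => u v E; rewrite /bihom.
  case: eqP => ud; last by rewrite mul0r.
  case: eqP => ve; last by rewrite mulr0.
  case/negP: wde; rewrite daddE /dx /dy -ud -ve E /bideg.
  by rewrite bidegx_cat bidegy_cat.
apply: eq_conv => u v E; rewrite /bihom.
have [->|/HF[Fx Fy]] := eqVneq (F u) 0; first by rewrite if_same !mul0r.
have [->|/HG[Gx Gy]] := eqVneq (G v) 0; first by rewrite if_same !mulr0.
move: wde; rewrite daddE E /bideg bidegx_cat bidegy_cat => /eqP[Ex Ey].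
rewrite [val d]surjective_pairing [val e]surjective_pairing -!/(dx _) -!/(dy _).
have [-> ->] : bidegx u = dx d /\ bidegy u = dy d by lia.
have [-> ->] : bidegx v = dx e /\ bidegy v = dy e by lia.
by rewrite !eqxx.
Qed.

End Bidegree.

(** * The double lower central series under the Magnus embedding *)

Section MagnusFiltration.
Variables p q : nat.
Local Notation S := ('I_p + 'I_q)%type.
Local Notation T := (free_triple p q).
Local Notation D d := (dlcsT T (dx d) (dy d)).
Local Notation K := (free_group S).
Implicit Types (g h : K) (d e : N2p) (w : seq S).

Definition magnus_filt m n : set K := fun g => bideal m n (magnus g - 1).

(** These are the elements congruent to 1 modulo a two-sided ideal. *)
Lemma magnus_filt_normal m n : is_normal (magnus_filt m n).
Proof.
split; first split.
- by rewrite /magnus_filt /= magnus1 subrr; exact: bideal0.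
- move=> g h; rewrite /magnus_filt /= magnusM => Hg Hh.
  have -> : magnus g * magnus h - 1 = (magnus g - 1) * magnus h + (magnus h - 1).
    by rewrite mulrBl mul1r addrA subrK.
  by apply: bidealD => //; exact: bidealMr.
- move=> g; rewrite /magnus_filt /= => Hg.
  have -> : magnus g^-1%g - 1 = - ((magnus g - 1) * magnus g^-1%g).
    by rewrite mulrBl mul1r magnusKV opprB.
  by apply: bidealN; exact: bidealMr.
move=> g h; rewrite /magnus_filt /= !magnusM => Hh.
rewrite -[X in _ - X](magnusKV g) -mulrBl -{2}[magnus g]mulr1 -mulrBr.
by apply: bidealMr; exact: bidealMl.
Qed.

Lemma magnus_filt_comm m n m' n' g h :
  magnus_filt m n g -> magnus_filt m' n' h ->
  magnus_filt (m + m') (n + n') (comm g h).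
Proof.
rewrite /magnus_filt /= => Hg Hh; rewrite magnus_comm.
by apply: bidealMr; exact: bideal_lbr.
Qed.

Lemma magnus_filt_commS m n m' n' (G H : set K) :
  (G `<=` magnus_filt m n)%classic -> (H `<=` magnus_filt m' n')%classic ->
  (commS G H `<=` magnus_filt (m + m') (n + n'))%classic.
Proof.
move=> Gm Hm; apply: commS_min; first exact: nrm_sub (magnus_filt_normal _ _).
by move=> g h /Gm Hg /Hm Hh; exact: magnus_filt_comm.
Qed.

(** The generators go to 1 plus a letter, and the normal subgroups [magnus_filt] follow the normal
    closures, commutators and products of the recursion. *)
Lemma dlcs_magnus m n : (dlcsT T m n `<=` magnus_filt m n)%classic.
Proof.
have X1 : (@nt_X T `<=` magnus_filt 1 0)%classic.
  move=> g; apply; first exact: magnus_filt_normal.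
  move=> _ [i _ <-] w; rewrite magnus_genE addrC addKr /letter.
  by case: (w =P _) => [->|].
have Y1 : (@nt_Y T `<=` magnus_filt 0 1)%classic.
  move=> g; apply; first exact: magnus_filt_normal.
  move=> _ [i _ <-] w; rewrite magnus_genE addrC addKr /letter.
  by case: (w =P _) => [->|].
rewrite /dlcsT; elim: m n => [|m IHm] n.
  case: n => [|n]; first by move=> g _; exact: bideal00.
  elim: n => [|n IHn] //.
  by have := magnus_filt_commS IHn Y1; rewrite addn1.
elim: n => [|n IHn].
  elim: m {IHm} => [|m IHm] //.
  by have := magnus_filt_commS IHm X1; rewrite addn1.
rewrite dlcsSS; apply: mulS_min; first exact: nrm_sub (magnus_filt_normal _ _).
  exact: (magnus_filt_commS X1 (IHm n.+1)).
exact: (magnus_filt_commS Y1 IHn).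
Qed.

(** gh - 1 = (g - 1)(h - 1) + (g - 1) + (h - 1), and the words of the product have bidegree at least
    2d, which [d] does not reach because it is nonzero. *)
Lemma magnus_coefM d g h w : D d g -> D d h -> bideg w = val d ->
  magnus (g * h)%g w = magnus g w + magnus h w.
Proof.
move=> /dlcs_magnus Hg /dlcs_magnus Hh wd.
have -> : magnus (g * h)%g =
    (magnus g - 1) * (magnus h - 1) + (magnus g + magnus h - 1).
  rewrite magnusM mulrBl mulrBr mulr1 mul1r -[_ - _ - (_ - _)]addrA -opprD.
  by rewrite -[magnus g + magnus h - 1]addrA subrK.
have w0 : (1 : series S) w = 0.
  rewrite series1E -bideg_eq0 wd; case: d {Hg Hh wd} => d /= /negbTE ->; by [].
have [z|/(bidealM Hg Hh)] := eqVneq (((magnus g - 1) * (magnus h - 1)) w) 0.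
  by rewrite seriesDE z seriesBE seriesDE w0 subr0 add0r.
have := N2p_neq0 d; rewrite -[dx d]/((val d).1) -[dy d]/((val d).2) -wd /=.
by rewrite xpair_eqE; lia.
Qed.

End MagnusFiltration.

(* The theorem does not depend on the order of the letters. *)
Section SumOrder.
Variables p q : nat.

Let le (x y : 'I_p + 'I_q) := (unsplit x <= unsplit y)%N.

Fact sum_le_anti : antisymmetric le.
Proof. by move=> x y /anti_leq /val_inj /(can_inj (@unsplitK p q)). Qed.

Fact sum_display : Order.disp_t. Proof. exact: Order.Disp tt tt. Qed.

HB.instance Definition _ := Order.Le_isPOrder.Build sum_display ('I_p + 'I_q)%type
  (fun _ => leqnn _) sum_le_anti (fun _ _ _ => @leq_trans _ _ _).
HB.instance Definition _ := Order.POrder_isTotal.Build sum_display ('I_p + 'I_q)%type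
  (fun _ _ => leq_total _ _).

End SumOrder.

(** * The graded Magnus map and the injectivity of [phi] *)

Lemma grK_sum (T : normal_triple) (u : grK T) :
  exists s : seq N2p, u = \sum_(d <- s) grK_in (grK_coef u d).
Proof.
have [s us] := grK_supp u; exists (undup s); apply: grK_ext => e.
rewrite (big_morph (fun v : grK T => grK_coef v e) (fun _ _ => erefl) erefl).
have [es|es] := boolP (e \in s).
  rewrite (bigD1_seq e) ?undup_uniq ?mem_undup //= grK_inE big1 ?addr0 // => f fe.
  by rewrite grK_in_out // eq_sym.
rewrite us // big_seq big1 // => f; rewrite mem_undup => fs.
by rewrite grK_in_out //; apply: contraNneq es => ->.
Qed.

Lemma grK_ind (T : normal_triple) (P : grK T -> Prop) :
  P 0 -> (forall u v, P u -> P v -> P (u + v)) ->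
  (forall d g, dlcsT T (dx d) (dy d) g -> P (grK_in (cls d g))) ->
  forall u, P u.
Proof.
move=> P0 PD PI u; have [s ->] := grK_sum u.
by apply: big_ind => // d _; rewrite -[grK_coef u d]repK; apply: PI; exact: rep_in.
Qed.

Section GradedMagnus.
Variables p q : nat.
Local Notation S := ('I_p + 'I_q)%type.
Local Notation T := (free_triple p q).
Local Notation D d := (dlcsT T (dx d) (dy d)).
Local Notation K := (free_group S).
Implicit Types (g h : K) (d e : N2p) (w : seq S) (u v : grK T).

Lemma bideg_one w d : bideg w = val d -> (1 : series S) w = 0.
Proof.
move=> wd; rewrite series1E -bideg_eq0 wd.
by case: d {wd} => d /= /negbTE ->.
Qed.

(** A word of bidegree [d] has too few letters of the first kind for one factor of [dlcsT_gt] and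
    too few of the second kind for the other. *)
Lemma magnus_coef_gt d g w :
  dlcsT_gt T (dx d) (dy d) g -> bideg w = val d -> magnus g w = 0.
Proof.
move=> [s [t [Ds Dt ->]]] wd; have w0 := bideg_one wd.
rewrite (magnus_coefM (dlcs_decrX Ds) (dlcs_decrY Dt) wd).
have [wx wy] : bidegx w = dx d /\ bidegy w = dy d by rewrite /dx /dy -wd.
have minus1 (g' : K) : magnus g' w = (magnus g' - 1) w.
  by rewrite seriesBE w0 subr0.
rewrite !minus1.
have [->|/(dlcs_magnus Ds)] := eqVneq ((magnus s - 1) w) 0; last first.
  by rewrite wx ltnn => -[].
have [->|/(dlcs_magnus Dt)] := eqVneq ((magnus t - 1) w) 0; last first.
  by rewrite wy ltnn => -[].
by rewrite addr0.
Qed.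

Lemma magnus_cls d g h w : D d g -> D d h -> cls d (g : T) = cls d (h : T) ->
  bideg w = val d -> magnus g w = magnus h w.
Proof.
move=> Dg Dh /(clsP Dg Dh) N wd; have -> : h = (g * (g^-1 * h))%g by rewrite mulVKg.
rewrite (magnus_coefM Dg (dlcs_gt_le N) wd).
by rewrite [X in _ + X](magnus_coef_gt N wd) addr0.
Qed.

Variant bideg_spec w : option N2p -> Type :=
| BidegNone of bideg w = (0, 0)%N : bideg_spec w None
| BidegSome d of bideg w = val d : bideg_spec w (Some d).

Lemma bidegP w : bideg_spec w (insub (bideg w)).
Proof. by case: insubP => [d _ /esym|/negPn /eqP]; [right|left]. Qed.

(** Each coefficient is read off a representative of the one component whose degree is the bidegree
    of the word; by [magnus_cls] the representative is immaterial. The empty word has bidegree (0,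
    0), outside [N2p], and gets 0. *)
Definition gr_magnus u : series S := fun w =>
  if insub (bideg w) is Some d then magnus (rep (grK_coef u d) : K) w else 0.

Lemma gr_magnus_in d g : D d g ->
  gr_magnus (grK_in (cls d (g : T))) = bihom d (magnus g).
Proof.
move=> Dg; apply/funext => w; rewrite /gr_magnus /bihom.
case: bidegP => [w0|e we].
  by case: eqP => // wd; have := valP d; rewrite /= -wd w0.
have [ed|ed] := eqVneq e d; last first.
  rewrite grK_in_out // we (inj_eq val_inj) (negbTE ed).
  (* The component of degree [e] is the class of the neutral element, whose series 1 has no word of
     nonzero bidegree. *)
  rewrite (@magnus_cls e _ 1%g) ?magnus1 ?(bideg_one we) //.
  - exact: rep_in.
  - exact: sub1 (@dlcs_sub _ _ _).
  - by rewrite repK.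
subst e; rewrite we eqxx; apply: (@magnus_cls d) => //; first exact: rep_in.
by rewrite repK grK_inE.
Qed.

Lemma gr_magnusD u v : gr_magnus (u + v) = gr_magnus u + gr_magnus v.
Proof.
apply/funext => w; rewrite seriesDE /gr_magnus.
case: bidegP => [_|e we]; first by rewrite addr0.
have [Du Dv] := (rep_in (grK_coef u e), rep_in (grK_coef v e)).
rewrite -(magnus_coefM Du Dv) //; apply: (@magnus_cls e) => //; first exact: rep_in.
  exact: subM (@dlcs_sub _ _ _) Du Dv.
by rewrite repK clsM // !repK.
Qed.

(** By biadditivity it suffices to treat classes of group elements, where [magnus_comm] is compared
    in the lowest bidegree. *)
Lemma gr_magnus_lbr u v : gr_magnus (lbr u v) = lbr (gr_magnus u) (gr_magnus v).
Proof.
have gr0 : gr_magnus 0 = 0.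
  by apply: (addrI (gr_magnus 0)); rewrite -gr_magnusD !addr0.
elim/grK_ind: u => [|u u' Hu Hu'|d g Dg].
- by rewrite lbr0l gr0 lbr0l.
- by rewrite lbrDl !gr_magnusD Hu Hu' lbrDl.
elim/grK_ind: v => [|v v' Hv Hv'|e h Dh].
- by rewrite (lbrC _ 0) lbr0l oppr0 gr0 (lbrC _ 0) lbr0l oppr0.
- by rewrite lbrDr !gr_magnusD Hv Hv' lbrDr.
have Dgh := dsum_in (dsum_dadd d e) Dg Dh.
rewrite grK_in_cls_br // !gr_magnus_in //; apply/funext => w.
(* Subtracting 1 does not affect components of nonzero bidegree, and puts the series in the ideals
   required by [bihom_conv]. *)
have part f (k : K) x : D f k -> bihom f (magnus k) x = bihom f (magnus k - 1) x.
  move=> _; rewrite /bihom; case: eqP => // xf.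
  by rewrite seriesBE (bideg_one xf) subr0.
have -> : bihom d (magnus g) = bihom d (magnus g - 1).
  by apply/funext => x; exact: part.
have -> : bihom e (magnus h) = bihom e (magnus h - 1).
  by apply/funext => x; exact: part.
rewrite part // magnus_comm series_lbrE.
rewrite (bihom_conv _ (dlcs_magnus Dg) (dlcs_magnus Dh)).
rewrite (bihom_conv _ (dlcs_magnus Dh) (dlcs_magnus Dg)).
have -> : val (dadd e d) = val (dadd d e) by rewrite !daddE addnC [(dy e + _)%N]addnC.
rewrite {1}/bihom; case: eqP => [wde|_]; last by rewrite subr0.
(* The last factor contributes only its constant term 1: the commutator already uses up the whole
   bidegree of [w], which leaves the empty word. *)
rewrite -series_lbrE seriesME -{1}[w]cats0 conv_split ?magnus_const ?mulr1 //.
move=> w1 w2; rewrite cats0 => E sw.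
have [->|/(bideal_lbr (dlcs_magnus Dg) (dlcs_magnus Dh)) [bx1 by1]] :=
  eqVneq ((lbr (magnus g - 1) (magnus h - 1)) w1) 0; first exact: mul0r.
move: wde; rewrite daddE E /bideg bidegx_cat bidegy_cat => -[bx by'].
have : bideg w2 == (0, 0)%N by rewrite /bideg xpair_eqE; lia.
by rewrite bideg_eq0 => /eqP w20; rewrite E w20 cats0 eqxx in sw.
Qed.

(** Both sides are Lie morphisms sending each generator to its letter, so the universal property
    identifies them. *)
Lemma gr_magnus_phi (x : free_lie S) : gr_magnus (phi x) = lie_lift (@letter S) x.
Proof.
apply: (@lie_lift_unique _ _ _ (fun x => gr_magnus (phi x))).
  have [phiD phiB] := lie_lift_morphism (@phi_gen p q).
  split=> u v; rewrite /phi; first by rewrite phiD gr_magnusD.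
  by rewrite phiB gr_magnus_lbr.
have single d s : bideg [:: s] = val d -> D d (fg_gen s : K) ->
    gr_magnus (grK_in (cls d (fg_gen s : T))) = letter s.
  move=> sd Ds; rewrite gr_magnus_in // magnus_genE; apply/funext => w.
  rewrite /bihom seriesDE /letter; case: eqP => [wd|].
    by rewrite (bideg_one wd) add0r.
  by case: eqP => // ->.
move=> s; rewrite /phi lie_lift_gen; case: s => [i|j]; apply: single => //.
  exact: fgx_in.
exact: fgy_in.
Qed.

Lemma phi_inj : injective (@phi p q).
Proof.
move=> x y /(congr1 gr_magnus); rewrite !gr_magnus_phi.
exact: free_lie_series_inj.
Qed.

End GradedMagnus.

(** * Surjectivity *)

Lemma grK_inD (T : normal_triple) d (x y : barK T d) :
  grK_in (x + y) = grK_in x + grK_in y.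
Proof.
apply: grK_ext => e; rewrite grK_coefD.
have [->|ed] := eqVneq e d; first by rewrite !grK_inE.
by rewrite !grK_in_out ?addr0.
Qed.

Section Surjectivity.
Variables p q : nat.
Local Notation S := ('I_p + 'I_q)%type.
Local Notation T := (free_triple p q).
Local Notation D d := (dlcsT T (dx d) (dy d)).
Local Notation K := (free_group S).
Local Notation phi := (@phi p q).
Implicit Types (g h : K) (d e : N2p) (u v : free_lie S).

Lemma phiD : {morph phi : u v / u + v}.
Proof. exact: (lie_lift_morphism _).1. Qed.

Lemma phi_lbr : {morph phi : u v / lbr u v}.
Proof. exact: (lie_lift_morphism _).2. Qed.

Lemma phi0 : phi 0 = 0.
Proof. by apply: (addrI (phi 0)); rewrite -phiD !addr0. Qed.

Lemma phiN u : phi (- u) = - phi u.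
Proof. by apply/eqP; rewrite -addr_eq0 -phiD addNr phi0. Qed.

(** [cls_conj] asks for a conjugating element of nonzero degree, which a general [g] is not;
    conjugation is done letter by letter, each generator having degree [d10] or [d01]. *)
Lemma cls_conj_free d g h : D d h -> cls d (g * h * g^-1 : T)%g = cls d (h : T).
Proof.
have conj s (k : K) : D d k ->
    cls d (fg_gen s * k * (fg_gen s)^-1 : T)%g = cls d (k : T) /\
    cls d ((fg_gen s)^-1 * k * (fg_gen s)^-1^-1 : T)%g = cls d (k : T).
  move=> Dk; have [e De] : exists e, D e (fg_gen s : K).
    by case: s => i; [exists d10; exact: fgx_in|exists d01; exact: fgy_in].
  by split; apply: (@cls_conj _ d e) => //; exact: subV (@dlcs_sub _ _ _) De.
have shift (k k' : K) : (k * k' * h * (k * k')^-1 = k * (k' * h * k'^-1) * k^-1)%g.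
  by rewrite invgM !mulgA.
move=> Dh; elim/free_group_ind: g => [|s g IH|s g IH].
- by rewrite mul1g invg1 mulg1.
- rewrite shift (conj s _ _).1 //; exact: nrm_conj (@dlcs_normal _ _ _) Dh.
- rewrite shift (conj s _ _).2 //; exact: nrm_conj (@dlcs_normal _ _ _) Dh.
Qed.

(** Preimages are required in the piece of the same degree, which yields surjectivity degree by
    degree. Quantifying over [d] allows any two naturals as index; at (0, 0) the second condition is
    empty. *)
Definition phi_image m n : set T := fun g =>
  dlcsT T m n g /\ forall d, val d = (m, n) ->
    exists2 u, fl_deg m n u & phi u = grK_in (cls d (g : T)).

Lemma phi_image_subgroup m n : is_subgroup (phi_image m n).
Proof.
have sD := @dlcs_sub T m n.
split=> [|g h [Dg Hg] [Dh Hh]|g [Dg Hg]].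
- split; first exact: sub1 sD.
  move=> d _; exists 0; first exact: FlDeg0.
  by rewrite phi0; apply: (addrI (grK_in (cls d 1%g))); rewrite -grK_inD !addr0.
- split; first exact: subM sD Dg Dh.
  move=> d dmn; have [[u Lu Eu] [v Lv Ev]] := (Hg d dmn, Hh d dmn).
  exists (u + v); first exact: FlDegD.
  by rewrite phiD Eu Ev -grK_inD clsM // /dx /dy dmn.
- split; first exact: subV sD Dg.
  move=> d dmn; have [u Lu Eu] := Hg d dmn.
  exists (- u); first exact: FlDegN.
  rewrite phiN Eu clsV /dx /dy ?dmn //; apply/eqP.
  rewrite eq_sym -addr_eq0 -grK_inD addNr.
  by apply/eqP/(addrI (grK_in (cls d g))); rewrite -grK_inD !addr0.
Qed.

Lemma phi_image_comm m n m' n' g h :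
  (m, n) != (0, 0)%N -> (m', n') != (0, 0)%N ->
  phi_image m n g -> phi_image m' n' h ->
  phi_image (m + m') (n + n') (comm g h).
Proof.
move=> mn0 mn0' [Dg Hg] [Dh Hh]; split; first exact: dlcs_comm.
move=> d dmn; pose e : N2p := Sub (m, n) mn0; pose e' : N2p := Sub (m', n') mn0'.
have [u Lu Eu] := Hg e erefl; have [v Lv Ev] := Hh e' erefl.
exists (lbr u v); first exact: FlDegBr.
have -> : d = dadd e e' by apply: val_inj; rewrite dmn daddE.
by rewrite phi_lbr Eu Ev grK_in_cls_br.
Qed.

Lemma phi_image_commS m n m' n' (G H : set K) :
  (G `<=` phi_image m n)%classic -> (H `<=` phi_image m' n')%classic ->
  (m, n) != (0, 0)%N -> (m', n') != (0, 0)%N ->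
  (commS G H `<=` phi_image (m + m') (n + n'))%classic.
Proof.
move=> Gm Hm mn0 mn0'; apply: commS_min; first exact: phi_image_subgroup.
by move=> g h /Gm Hg /Hm Hh; exact: phi_image_comm.
Qed.

(** Conjugate elements have equal classes, hence a common preimage. Normality is what carries the
    image from the generators to their normal closures. *)
Lemma phi_image_normal d : is_normal (phi_image (dx d) (dy d)).
Proof.
split; first exact: phi_image_subgroup.
move=> g h [Dh Hh]; split; first exact: nrm_conj (@dlcs_normal _ _ _) Dh.
move=> e /[dup] ed /Hh [u Lu Eu]; exists u => //.
by rewrite cls_conj_free // /dx /dy ed.
Qed.

(** Along the recursion of the series, the class of a commutator has as preimage the bracket of
    preimages. *)
Lemma dlcs_phi_image m n :
  (m, n) != (0, 0)%N -> (dlcsT T m n `<=` phi_image m n)%classic.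
Proof.
have X1 : (@nt_X T `<=` phi_image 1 0)%classic.
  move=> g; apply; first exact: (phi_image_normal d10).
  move=> _ [i _ <-]; split; first exact: fgx_in.
  move=> d d1; have -> : d = d10 by exact: val_inj.
  by exists (fl_gen (inl i)); [exact: FlDegA|rewrite [LHS]lie_lift_gen].
have Y1 : (@nt_Y T `<=` phi_image 0 1)%classic.
  move=> g; apply; first exact: (phi_image_normal d01).
  move=> _ [i _ <-]; split; first exact: fgy_in.
  move=> d d1; have -> : d = d01 by exact: val_inj.
  by exists (fl_gen (inr i)); [exact: FlDegB|rewrite [LHS]lie_lift_gen].
rewrite /dlcsT; elim: m n => [|m IHm] n.
  (* Degree (0, 0) is excluded by hypothesis, so the induction along the axis starts from the
     subgroup Y itself. *)
  case: n => [|n] // _; elim: n => [|n IHn] //.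
  by have := phi_image_commS IHn Y1 isT isT; rewrite addn1.
move=> _; elim: n => [|n IHn].
  elim: m {IHm} => [|m IHm] //.
  by have := phi_image_commS IHm X1 isT isT; rewrite addn1.
rewrite dlcsSS; apply: mulS_min; first exact: phi_image_subgroup.
  by apply: (phi_image_commS X1 (IHm n.+1 _)) => //; rewrite xpair_eqE andbF.
exact: (phi_image_commS Y1 IHn).
Qed.

(** Induction on the derivation of the degree; for a bracket, [hbr] pairs the only components that
    may be nonzero and lands in the sum of their degrees. *)
Lemma phi_deg_coef m n u e : fl_deg m n u -> val e != (m, n) -> grK_coef (phi u) e = 0.
Proof.
move=> Lu; elim: Lu e => {m n u} [i|j|m n|m n u v _ Hu _ Hv|m n u _ Hu|
    m n m' n' u v _ Hu _ Hv] e ne.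
- by rewrite [phi _]lie_lift_gen grK_in_out.
- by rewrite [phi _]lie_lift_gen grK_in_out.
- by rewrite phi0.
- by rewrite phiD grK_coefD Hu ?Hv ?addr0.
- by rewrite phiN -[LHS]/(- grK_coef (phi u) e) Hu ?oppr0.
rewrite phi_lbr [LHS]grK_brE big1 // => a _; rewrite big1 // => b _.
have [va|/Hu->] := eqVneq (val a) (m, n); last exact: hbr0l.
have [vb|/Hv->] := eqVneq (val b) (m', n'); last exact: hbr0r.
rewrite hbr_out // is_dsumP -val_eqE daddE; apply: contraNF ne.
by rewrite /dx /dy va vb.
Qed.

Lemma phi_deg_onto d (x : barK T d) : exists2 u, fl_piece d u & phi u = grK_in x.
Proof.
have [_] := dlcs_phi_image (N2p_neq0 d) (rep_in x).
move=> /(_ d); rewrite repK; apply; exact: surjective_pairing.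
Qed.

Lemma phi_onto (v : grK T) : exists u, phi u = v.
Proof.
have [s ->] := grK_sum v.
apply: (big_ind (fun v : grK T => exists u, phi u = v)) => [|x y [u <-] [w <-]|d _].
- by exists 0; exact: phi0.
- by exists (u + w); exact: phiD.
by have [u _ <-] := phi_deg_onto (grK_coef v d); exists u.
Qed.

Lemma phi_image_deg d : (phi @` fl_piece d = grK_deg d)%classic.
Proof.
apply/seteqP; split=> [_ [u Lu <-] e ed|v vd].
  by apply: phi_deg_coef Lu _; rewrite /dx /dy -surjective_pairing (inj_eq val_inj).
have [u Lu Eu] := phi_deg_onto (grK_coef v d); exists u => //.
rewrite Eu; apply: grK_ext => e.
by have [->|ed] := eqVneq e d; [rewrite grK_inE|rewrite grK_in_out // vd].
Qed.

Definition phi_piece d (u : free_lie_deg 'I_p 'I_q d) : barK T d :=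
  grK_coef (phi (val u)) d.

Fact phi_piece_nmod_morphism d : nmod_morphism (@phi_piece d).
Proof.
split=> [|u v]; rewrite /phi_piece ?raddf0 ?phi0 //.
by rewrite raddfD phiD.
Qed.

HB.instance Definition _ d := GRing.isNmodMorphism.Build
  (free_lie_deg 'I_p 'I_q d) (barK T d) (@phi_piece d) (phi_piece_nmod_morphism d).

(** The image has no component outside degree [d], so reading off that one keeps the injectivity of
    [phi]; homogeneous preimages give surjectivity. *)
Lemma phi_piece_bij d : bijective (@phi_piece d).
Proof.
have inj : injective (@phi_piece d).
  move=> u v; rewrite /phi_piece => uv; apply/val_inj/phi_inj/grK_ext => e.
  have [->//|ed] := eqVneq e d.
  have piece (w : free_lie_deg 'I_p 'I_q d) : fl_piece d (val w).
    by apply/asboolP; exact: (valP w).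
  have ed' : val e != (dx d, dy d).
    by rewrite /dx /dy -surjective_pairing (inj_eq val_inj).
  by rewrite !(phi_deg_coef (piece _)).
have surj (x : barK T d) : exists u : free_lie_deg 'I_p 'I_q d, phi_piece u = x.
  have [u Lu Eu] := phi_deg_onto x.
  by exists (Sub u (asboolT Lu)); rewrite /phi_piece /= Eu grK_inE.
have [f fK] := choice surj.
by exists f => // u; apply: inj; exact: fK.
Qed.

End Surjectivity.

Local Close Scope ring_scope.
Local Close Scope quotient_scope.

Theorem theorem3p13 (p q : nat) (hp : 1 <= p) (hq : 1 <= q) :
  is_graded_lie_iso (@fl_piece 'I_p 'I_q) (@grK_deg (free_triple p q))
    (@phi p q)
  /\ forall d : N2p,
       exists f : {additive free_lie_deg 'I_p 'I_q d -> barK (free_triple p q) d},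
         bijective f.
Proof.
split; last by move=> d; exists (@phi_piece p q d); exact: phi_piece_bij.
split; [exact: lie_lift_morphism| |exact: phi_image_deg].
(* A choice of preimages is a right inverse, which injectivity makes two-sided. *)
have [f fK] := choice (@phi_onto p q).
by exists f => // u; apply: phi_inj; exact: fK.
Qed.
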